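(* For every rational threshold $\rho\in (0,1)$ whose denominator is bounded above by a constant, the problem GtTHR$_\rho$-3SAT is in $\mathsf{P}$.
   Context: A 3-CNF is a conjunction of clauses each with at most 3 literals. GtTHR$_\rho$-3SAT is the problem: given a 3-CNF $\varphi$ on $n$ variables, decide whether $\varphi$ has strictly more than $\rho \cdot 2^n$ satisfying assignments. *)

(* Defs.v *)
From Corelib Require Import BinNums.
From HB Require Import structures.
From mathcomp Require Import all_boot all_order all_algebra.

Set Implicit Arguments.
Unset Strict Implicit.
Unset Printing Implicit Defensive.

Import Order.TTheory GRing.Theory Num.Theory.

(** * Deterministic multi-tape Turing machines and the class P *)

Inductive direction := Left | Stay | Right.

(* A two-way infinite tape over [A], blank outside of a finite zone:
   [left_cells] and [right_cells] list the cells on each side of the head,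
   nearest first, and the cells past their ends are blank ([None]). *)
Record tape (A : Type) := Tape {
  left_cells : seq (option A);
  scanned : option A;
  right_cells : seq (option A) }.

Definition blank_tape (A : Type) : tape A := Tape [::] None [::].

(* The head is on the first letter of [w]. *)
Definition tape_of_word (A : Type) (w : seq A) : tape A :=
  Tape [::] (ohead w) (map Some (behead w)).

Definition write (A : Type) (t : tape A) (a : option A) : tape A :=
  Tape (left_cells t) a (right_cells t).

Definition shift (A : Type) (t : tape A) (d : direction) : tape A :=
  match d with
  | Left => Tape (behead (left_cells t)) (head None (left_cells t))
                 (scanned t :: right_cells t)
  | Stay => t
  | Right => Tape (scanned t :: left_cells t) (head None (right_cells t))
                  (behead (right_cells t))
  end.

(* The letters of the tapes are the input letters and the elements of [work]; a
   machine has [extra.+1] tapes, and its input is on tape [ord0]. *)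
Record machine (Sigma : finType) := Machine {
  extra : nat;
  work : finType;
  state : finType;
  start : state;
  halting : pred state;
  accepting : pred state;
  transition : state -> {ffun 'I_extra.+1 -> option (Sigma + work)} ->
    state * {ffun 'I_extra.+1 -> option (Sigma + work) * direction} }.

Definition config (Sigma : finType) (M : machine Sigma) : Type :=
  (state M * {ffun 'I_(extra M).+1 -> tape (Sigma + work M)})%type.

Definition init (Sigma : finType) (M : machine Sigma) (w : seq Sigma) :
    config M :=
  (start M, [ffun i => if i == ord0 then tape_of_word (map inl w)
                       else blank_tape (Sigma + work M)]).

(* A configuration in a halting state is final: it is its own successor. *)
Definition step (Sigma : finType) (M : machine Sigma) (c : config M) :
    config M :=
  if halting c.1 then c else
  let: (q, act) := transition c.1 [ffun i => scanned (c.2 i)] in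
  (q, [ffun i => shift (write (c.2 i) (act i).1) (act i).2]).

Definition run (Sigma : finType) (M : machine Sigma) (t : nat)
    (w : seq Sigma) : config M :=
  iter t (@step Sigma M) (init M w).

Definition in_P (Sigma : finType) (L : seq Sigma -> Prop) : Prop :=
  exists (M : machine Sigma) (p : {poly nat}), forall w : seq Sigma,
    let q := (run M p.[size w]%R w).1 in
    halting q /\ (accepting q <-> L w).

(** * CNF formulas *)

(* [(i, true)] is the variable of index [i], and [(i, false)] its negation. *)
Definition literal (n : nat) : Type := ('I_n * bool)%type.
Definition clause (n : nat) : Type := seq (literal n).
Definition cnf (n : nat) : Type := seq (clause n).

Definition is_kcnf (k n : nat) (phi : cnf n) : bool :=
  all (fun c : clause n => size c <= k) phi.

Definition satisfies (n : nat) (a : {ffun 'I_n -> bool}) (phi : cnf n) : bool :=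
  all (fun c : clause n => has (fun l : literal n => a l.1 == l.2) c) phi.

Definition num_sat (n : nat) (phi : cnf n) : nat :=
  #|[set a : {ffun 'I_n -> bool} | satisfies a phi]|.

(** * Formulas as words *)

Inductive symbol := Bit of bool | Literal of bool | Clause.

Definition symbol_code (s : symbol) : option (bool + bool) :=
  match s with
  | Bit b => Some (inl b)
  | Literal b => Some (inr b)
  | Clause => None
  end.

Definition symbol_decode (c : option (bool + bool)) : symbol :=
  match c with
  | Some (inl b) => Bit b
  | Some (inr b) => Literal b
  | None => Clause
  end.

Lemma symbol_codeK : cancel symbol_code symbol_decode.
Proof. by case. Qed.

HB.instance Definition _ := Finite.copy symbol (can_type symbol_codeK).

Fixpoint bits_of_pos (p : positive) : seq bool :=
  match p with
  | xH => [:: true]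
  | xO p' => false :: bits_of_pos p'
  | xI p' => true :: bits_of_pos p'
  end.

(* The binary digits of [m], least significant first and with no superfluous
   zero; the word of 0 is empty. *)
Definition encode_nat (m : nat) : seq symbol :=
  if bin_of_nat m is Npos p then map Bit (bits_of_pos p) else [::].

Definition encode_literal (n : nat) (l : literal n) : seq symbol :=
  Literal l.2 :: encode_nat l.1.

Definition encode_clause (n : nat) (c : clause n) : seq symbol :=
  Clause :: flatten (map (@encode_literal n) c).

(* The number of variables is part of the instance: a formula need not mention
   all of its variables. *)
Definition encode_cnf (n : nat) (phi : cnf n) : seq symbol :=
  encode_nat n ++ flatten (map (@encode_clause n) phi).

(* A word which is not the code of a 3-CNF is not in the language. *)
Definition GtTHR_3SAT (rho : rat) (w : seq symbol) : Prop :=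
  exists (n : nat) (phi : cnf n),
    [/\ w = encode_cnf phi, is_kcnf 3 phi
      & (rho * 2 ^+ n < (num_sat phi)%:R)%R].

(* Main.v *)
(** Let P be the satisfaction probability.  A CNF with clauses of size at most k either
    contains many pairwise disjoint clauses of size k, hence has a small P, or has a
    bounded set of variables meeting all its clauses of size k; fixing these variables
    writes P as a bounded average of probabilities of formulas with smaller clauses.
    By induction on k, the set of the values of P contains no infinite increasing
    sequence, so no 3-CNF has its probability in some interval (rho - eps, rho), and for
    every eps a bounded set V of variables is such that keeping only the literals on V
    lowers P by at most eps.  With V meeting all clauses of size 3, this gives: P > rho
    if and only if, for some V of bounded size, the proportion of the assignments of V
    satisfying every clause by themselves is more than rho, or is equal to rho while some
    other assignment of V leaves a satisfiable 2-CNF.  (Tautological clauses are ignored.)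

    This criterion is a query on the positions of the input word, in first-order logic
    with reachability (2-CNF formulas are decided by paths in their implication graph),
    and queries are evaluated by a one-tape machine sweeping over its input, which keeps
    the values of the variables and the reached set as marks on the cells. *)

From Corelib Require Import BinNums.
Require Import Defs.
From mathcomp Require Import all_boot all_order all_algebra.
From mathcomp Require Import zify ring lra.
From Stdlib Require Import Classical IndefiniteDescription FunctionalExtensionality.

Set Implicit Arguments.
Unset Strict Implicit.
Unset Printing Implicit Defensive.

Import Order.TTheory GRing.Theory Num.Theory.

(** An approximation of P from below, with any error, cannot by itself separate P > rho from P =
    rho. The gap does: the formula kept on [V] is again a 3-CNF, so once its probability exceeds
    [rho - eps] it is at least [rho]. Only equality is left, and then a single satisfying assignment
    of the formula that falsifies the kept one makes the inequality strict; it extends an assignment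
    of [V], and after fixing [V] the unsatisfied clauses have at most two literals.

    The size [C] of [V] depends on [rho] alone. It is a constant built into the machine and is not
    computed: the gap comes from a classical argument by contradiction.

    Deleting literals never raises the probability, so acceptance is sound for every [V]. Hence [V]
    can be guessed, as [C] positions of the word bound by existential quantifiers, each costing a
    polynomial factor. A variable is named by the bits that follow an occurrence of it. Pointers may
    therefore repeat or designate no variable at all, and the counting of assignments has to be
    robust to this. *)

(** * Sweeping machines *)

(* A sweeper reads its tape from left to right again and again, and rewrites only the
   auxiliary letter of each cell; at the end of a sweep, [sfin] gives the state in which
   the next sweep starts, or the answer. *)
Record sweeper (G : finType) := Sweeper {
  aux : finType;
  aux0 : aux;
  sst : finType;
  sst0 : sst;
  sread : sst -> G -> aux -> sst * aux;
  sfin : sst -> sst + bool }.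

Fixpoint sweep (G : finType) (M : sweeper G) (q : sst M) (t : seq (G * aux M)) :
    sst M * seq (G * aux M) :=
  if t is (g, x) :: t' then
    let: (q1, x1) := sread q g x in
    let: (q2, t2) := sweep q1 t' in (q2, (g, x1) :: t2)
  else (q, [::]).

(** The index counts sweeps, not machine steps: a sweep costs time linear in the length of the tape,
    which sweeping preserves. *)
Inductive exec (G : finType) (M : sweeper G) :
    sst M -> seq (G * aux M) -> nat -> bool -> seq (G * aux M) -> Prop :=
| exec_stop q t b :
    sfin (sweep q t).1 = inr b -> exec q t 1 b (sweep q t).2
| exec_next q t q' k b t' :
    sfin (sweep q t).1 = inl q' -> exec q' (sweep q t).2 k b t' ->
    exec q t k.+1 b t'.

Lemma sweep_map1 (G : finType) (M : sweeper G) (q : sst M) t :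
  map fst (sweep q t).2 = map fst t.
Proof.
elim: t q => [|[g x] t IH] q //=; case: (sread q g x) => q1 x1.
by move: (IH q1); case: (sweep q1 t) => q2 t2 /= ->.
Qed.

(** A letter not yet visited is read as if it carried [aux0], so the input needs no formatting
    pass. *)
Definition cell_of (G : finType) (M : sweeper G) (l : G + G * aux M) : G * aux M :=
  match l with inl g => (g, aux0 M) | inr c => c end.

Definition tm_act (A : Type) (a : A) (d : direction) : {ffun 'I_1 -> A * direction} :=
  [ffun => (a, d)].

(* The state [inl (true, q)] sweeps to the right in state [q], and
   [inl (false, q)] rewinds the head before a sweep from state [q]. *)
Definition tm_transition (G : finType) (M : sweeper G) (s : (bool * sst M) + bool)
    (r : {ffun 'I_1 -> option (G + G * aux M)}) :
    ((bool * sst M) + bool) * {ffun 'I_1 -> option (G + G * aux M) * direction} :=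
  match s with
  | inr b => (inr b, tm_act (r ord0) Stay)
  | inl (true, q) =>
    if r ord0 is Some l then
      let: (g, x) := cell_of l in let: (q1, x1) := sread q g x in
      (inl (true, q1), tm_act (Some (inr (g, x1))) Right)
    else match sfin q with
         | inl q1 => (inl (false, q1), tm_act None Left)
         | inr b => (inr b, tm_act None Stay)
         end
  | inl (false, q) =>
    if r ord0 is Some l then (inl (false, q), tm_act (Some l) Left)
    else (inl (true, q), tm_act None Right)
  end.

Definition tm_of (G : finType) (M : sweeper G) : machine G :=
  @Machine G 0 (G * aux M)%type ((bool * sst M) + bool)%type (inl (true, sst0 M))
    (fun s => if s is inr _ then true else false)
    (fun s => if s is inr b then b else false)
    (@tm_transition G M).

Definition tape_at (A : Type) (L R : seq (option A)) : tape A :=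
  Tape L (head None R) (behead R).

Definition tm_cfg (G : finType) (M : sweeper G) (s : (bool * sst M) + bool)
    (t : tape (G + G * aux M)) : config (tm_of M) :=
  (s, [ffun => t]).

Lemma step_tm_cfg (G : finType) (M : sweeper G) (s : (bool * sst M) + bool) t :
  step (tm_cfg s t) =
  let: (s', act) := tm_transition s [ffun => scanned t] in
  tm_cfg s' (shift (write t (act ord0).1) (act ord0).2).
Proof.
rewrite /step /tm_cfg /=.
have -> : [ffun i : 'I_1 => scanned ([ffun=> t] i)] = [ffun => scanned t].
  by apply/ffunP=> i; rewrite !ffunE.
case: s => [[[] q]|b] /=; rewrite ?ffunE.
- case: (scanned t) => [l|]; last first.
    by case: (sfin q) => ?; congr pair; apply/ffunP=> i; rewrite !ffunE.
  case: (cell_of l) => g x; case: (sread q g x) => q1 x1.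
  by congr pair; apply/ffunP=> i; rewrite !ffunE.
- by case: (scanned t) => [l|]; congr pair; apply/ffunP=> i; rewrite !ffunE.
- by congr pair; apply/ffunP=> i; rewrite !ffunE; case: t.
Qed.

Lemma tm_forward (G : finType) (M : sweeper G) (u : seq (G + G * aux M)) q L R :
  let r := sweep q (map (@cell_of G M) u) in
  iter (size u) (@step G (tm_of M))
    (tm_cfg (inl (true, q)) (tape_at L (map Some u ++ R))) =
  tm_cfg (inl (true, r.1)) (tape_at (rev (map (Some \o inr) r.2) ++ L) R).
Proof.
elim: u q L => [|l u IH] q L //.
rewrite [size _]/= iterSr step_tm_cfg /= ffunE /=.
case: (cell_of l) => g x; case E: (sread q g x) => [q1 x1] /=.
rewrite ffunE /= -/(tape_at (Some (inr (g, x1)) :: L) (map Some u ++ R)) IH.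
by case: (sweep q1 _) => q2 t2 /=; rewrite rev_cons cat_rcons.
Qed.

Lemma tm_backward (G : finType) (M : sweeper G) (u : seq (G + G * aux M)) q L a R :
  iter (size u).+1 (@step G (tm_of M))
    (tm_cfg (inl (false, q)) (tape_at (rev (map Some u) ++ L) (Some a :: R))) =
  tm_cfg (inl (false, q)) (tape_at (behead L) (head None L :: map Some u ++ Some a :: R)).
Proof.
elim/last_ind: u a R => [|u b IH] a R.
  by rewrite /= step_tm_cfg /= !ffunE.
rewrite size_rcons iterSr step_tm_cfg /= !ffunE /= map_rcons rev_rcons /=.
by have := IH b (Some a :: R); rewrite /= cat_rcons => <-.
Qed.

(** Each turn of the head leaves explicit blank cells past an end of the word, so the two sides of
    the tape are tracked only up to blanks. *)
Definition blanks (A : eqType) (s : seq (option A)) := all (pred1 None) s.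

Lemma blanks_head (A : eqType) (s : seq (option A)) : blanks s -> head None s = None.
Proof. by case: s => //= a s /andP[/eqP]. Qed.

Lemma blanks_behead (A : eqType) (s : seq (option A)) : blanks s -> blanks (behead s).
Proof. by case: s => //= a s /andP[]. Qed.

Lemma sweep_size (G : finType) (M : sweeper G) (q : sst M) t :
  size (sweep q t).2 = size t.
Proof. by rewrite -(size_map fst) sweep_map1 size_map. Qed.

Lemma tm_round (G : finType) (M : sweeper G) (u : seq (G + G * aux M)) q L R :
  let r := sweep q (map (@cell_of G M) u) in
  blanks L -> blanks R ->
  match sfin r.1 with
  | inl q' => exists L' R', [/\ blanks L', blanks R' &
     iter ((size u).*2.+2) (@step G (tm_of M))
       (tm_cfg (inl (true, q)) (tape_at L (map Some u ++ R))) =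
     tm_cfg (inl (true, q')) (tape_at L' (map Some (map inr r.2) ++ R'))]
  | inr b => exists t, iter (size u).+1 (@step G (tm_of M))
      (tm_cfg (inl (true, q)) (tape_at L (map Some u ++ R))) = tm_cfg (inr b) t
  end.
Proof.
move=> r bL bR.
have fw := tm_forward u q L R.
have st1 : iter (size u).+1 (@step G (tm_of M))
      (tm_cfg (inl (true, q)) (tape_at L (map Some u ++ R))) =
    step (tm_cfg (inl (true, r.1)) (tape_at (rev (map (Some \o inr) r.2) ++ L) R)).
  by rewrite iterS fw.
rewrite step_tm_cfg /= ffunE (blanks_head bR) in st1.
case E: (sfin r.1) st1 => [q'|b] st1; last first.
  exact: ex_intro _ _ st1.
rewrite !ffunE /= in st1.
have sz : size r.2 = size u by rewrite sweep_size size_map.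
exists (None :: behead L), (None :: behead R); split.
- by rewrite /= blanks_behead.
- by rewrite /= blanks_behead.
(* The sweep and its turn on the right blank take [size u + 1] steps, and so do the rewind and its
   turn on the left blank. *)
have -> : (size u).*2.+2 = (1 + size u) + (size u).+1 by lia.
rewrite iterD [iter (size u).+1 _ _]iterS st1 iterD.
set w := map (Some \o inr) r.2.
have -> : map Some (map inr r.2) = w by rewrite -map_comp.
have szw : size w = size u by rewrite size_map.
have back : iter (size u) (@step G (tm_of M))
   (tm_cfg (inl (false, q'))
     (shift (write (tape_at (rev w ++ L) R) None) Left)) =
   tm_cfg (inl (false, q')) (tape_at (behead L) (None :: w ++ None :: behead R)).
  (* [tm_backward] wants a letter under the head. On the empty word the turn has already put the
     head on the left blank. *)
  rewrite -sz /w; case/lastP: r.2 => [|v x] /=; first by rewrite /tape_at /= (blanks_head bL).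
  rewrite size_rcons map_rcons rev_rcons cat_rcons /=.
  have := tm_backward (map inr v) q' L (inr x) (None :: behead R).
  by rewrite size_map -map_comp (blanks_head bL).
by rewrite back [iter 1 _ _]step_tm_cfg /= !ffunE.
Qed.

Lemma tm_exec (G : finType) (M : sweeper G) q t k b t' :
  @exec G M q t k b t' ->
  forall u L R, blanks L -> blanks R -> map (@cell_of G M) u = t ->
  exists j t1, j <= k * (size u).*2.+2 /\
    iter j (@step G (tm_of M)) (tm_cfg (inl (true, q)) (tape_at L (map Some u ++ R)))
      = tm_cfg (inr b) t1.
Proof.
elim=> {q t k b t'} [q t b Eb|q t q' k b t' Eq _ IH] u L R bL bR Et.
  have := tm_round u q bL bR; rewrite Et Eb => -[t1 Ht1].
  by exists (size u).+1, t1; split=> //; lia.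
have := tm_round u q bL bR; rewrite Et Eq => -[L' [R' [bL' bR' Hr]]].
have [|j [t1 [lej Hj]]] := IH (map inr (sweep q t).2) _ _ bL' bR'.
  by rewrite -map_comp map_id.
exists (j + (size u).*2.+2), t1; split; last by rewrite iterD Hr.
by move: lej; rewrite size_map sweep_size -Et size_map; lia.
Qed.

Lemma step_halted (G : finType) (M : sweeper G) b t j :
  iter j (@step G (tm_of M)) (tm_cfg (inr b) t) = tm_cfg (inr b) t.
Proof. by elim: j => //= j ->. Qed.

Lemma in_P_of_sweeper (G : finType) (M : sweeper G) (L : seq G -> Prop) c d :
  (forall w, exists k b t',
    [/\ exec (sst0 M) (map (fun g => (g, aux0 M)) w) k b t',
        k <= c * (size w).+1 ^ d & b <-> L w]) ->
  in_P L.
Proof.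
move=> H; exists (tm_of M).
(* The last factor, 2n + 2, bounds the number of steps of one round. *)
exists (c%:P * ('X + 1) ^+ d * ('X + 'X + (1 + 1)))%R => w.
have [k [b [t' [He lek HL]]]] := H w.
set p := (_ * _)%R.
have Ep : (p.[size w])%R = c * (size w).+1 ^ d * (size w).*2.+2.
  rewrite /p !hornerM horner_exp !hornerD !hornerX -polyC1 !hornerC.
  have -> : ((size w + 1 : nat) ^+ d)%R = (size w).+1 ^ d.
    have -> : ((size w + 1 : nat) = (size w).+1)%R by exact: addn1.
    by elim: d {H lek p} => // n IHn; rewrite exprS IHn expnS.
  congr (_ * _)%N; rewrite -addnn -addn2; reflexivity.
have [|||j [t1 [lej Hj]]] := tm_exec He (u := map inl w) (L := [::]) (R := [::]) => //.
  by rewrite -map_comp.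
(* A halted machine stays put, so running on up to the polynomial bound keeps the answer. *)
have -> : run (tm_of M) p.[size w]%R w = tm_cfg (inr b) t1.
  have lejp : j <= p.[size w]%R.
    by rewrite Ep (leq_trans lej) // size_map leq_mul2r lek orbT.
  rewrite -(subnK lejp) /run iterD.
  suff -> : init (tm_of M) w = tm_cfg (inl (true, sst0 M))
      (tape_at [::] (map Some (map inl w) ++ [::])).
    by rewrite Hj step_halted.
  congr pair; apply/ffunP=> i; rewrite !ffunE ord1 eqxx cats0.
  by case: w {H He lek HL p Ep lej Hj lejp} => [|g w].
by split.
Qed.

(** * Relations tested in polynomial time *)

Definition poly_bounded (f : nat -> nat) : Prop :=
  exists c d, forall n, f n <= c * n.+1 ^ d.

Lemma poly_bounded_leq (f g : nat -> nat) :
  (forall n, f n <= g n) -> poly_bounded g -> poly_bounded f.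
Proof. by move=> le [c [d H]]; exists c, d => n; exact: leq_trans (H n). Qed.

Lemma poly_bounded_const c : poly_bounded (fun => c).
Proof. by exists c, 0 => n; rewrite muln1. Qed.

Lemma poly_bounded_succ : poly_bounded succn.
Proof. by exists 1, 1 => n; rewrite mul1n expn1. Qed.

Lemma poly_bounded_add (f g : nat -> nat) :
  poly_bounded f -> poly_bounded g -> poly_bounded (fun n => f n + g n).
Proof.
move=> [c [d H]] [c' [d' H']]; exists (c + c'), (d + d') => n.
rewrite mulnDl leq_add ?(leq_trans (H n)) ?(leq_trans (H' n)) //.
  by rewrite leq_mul2l leq_pexp2l ?leq_addr ?orbT.
by rewrite leq_mul2l leq_pexp2l ?leq_addl ?orbT.
Qed.

Lemma poly_bounded_mul (f g : nat -> nat) :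
  poly_bounded f -> poly_bounded g -> poly_bounded (fun n => f n * g n).
Proof.
move=> [c [d H]] [c' [d' H']]; exists (c * c'), (d + d') => n.
by rewrite expnD mulnACA leq_mul.
Qed.

(* [R w b] means that [b] is an answer allowed on [w]; nothing is required on the words
   without any allowed answer.  The initial contents of the auxiliary cells are arbitrary,
   so that machines can be run one after the other without cleaning up. *)
Definition testable (G : finType) (R : seq G -> bool -> Prop) : Prop :=
  exists (M : sweeper G) (f : nat -> nat), poly_bounded f /\
    forall w b, R w b -> forall t : seq (G * aux M), map fst t = w ->
    exists k t', exec (sst0 M) t k b t' /\ k <= f (size w).

Lemma testable_sub (G : finType) (R R' : seq G -> bool -> Prop) :
  (forall w b, R' w b -> R w b) -> testable R -> testable R'.
Proof.
by move=> E [M [f [pf H]]]; exists M, f; split=> // w b /E; exact: H.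
Qed.

Lemma testable_dfa (G Q : finType) (delta : Q -> G -> Q) (q0 : Q) (acc : pred Q) :
  testable (fun w b => b = acc (foldl delta q0 w)).
Proof.
pose M := @Sweeper G unit tt Q q0 (fun q g x => (delta q g, x))
                   (fun q => inr (acc q)).
exists M, (fun => 1); split=> [|w b -> t <-]; first exact: poly_bounded_const.
exists 1, (sweep (q0 : sst M) t).2; split=> //.
have E q u : foldl delta q (map fst u) = (sweep (q : sst M) u).1.
  elim: u q => [|[a x] u IH] q //=; rewrite IH.
  by case: (@sweep G M (delta q a) u).
by rewrite E; exact: exec_stop.
Qed.

(* [M'] runs [M] as a subroutine through [iq] and [pi]; when [M] halts with the
   answer [b], [ret b] is either the next state of [M'] or its own answer. *)
Lemma exec_sim (G G' : finType) (M : sweeper G) (M' : sweeper G')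
    (iq : sst M -> sst M') (ret : bool -> sst M' + bool)
    (pi : G' * aux M' -> G * aux M) (F : Type) (rho : G' * aux M' -> F) :
  (forall q g' x', exists x'', let r := sread q (pi (g', x')).1 (pi (g', x')).2 in
     [/\ sread (iq q) g' x' = (iq r.1, x''),
         pi (g', x'') = ((pi (g', x')).1, r.2) & rho (g', x'') = rho (g', x')]) ->
  (forall q, sfin (iq q) =
     match sfin q with inl q1 => inl (iq q1) | inr b => ret b end) ->
  forall q t k b t1, exec q t k b t1 -> forall t', map pi t' = t ->
  exists t1', [/\ map pi t1' = t1, map rho t1' = map rho t' &
    match ret b with
    | inl q' => forall k2 b2 t2, exec q' t1' k2 b2 t2 -> exec (iq q) t' (k + k2) b2 t2
    | inr b' => exec (iq q) t' k b' t1'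
    end].
Proof.
move=> Hr Hf.
have Hs q t' : [/\ (sweep (iq q) t').1 = iq (sweep q (map pi t')).1,
    map pi (sweep (iq q) t').2 = (sweep q (map pi t')).2 &
    map rho (sweep (iq q) t').2 = map rho t'].
  elim: t' q => [|[g' x'] t' IH] q //=.
  have [x'' /= [E1 E2 E3]] := Hr q g' x'.
  rewrite E1; case Ep: (pi (g', x')) E1 E2 => [g x] /= E1 E2.
  case Er: (sread q g x) E1 E2 => [q1 x1] /= E1 E2.
  have := IH q1; case: (sweep (iq q1) t') => q2 t2 /=.
  by case: (sweep q1 _) => q3 t3 /= [-> -> ->]; rewrite E2 E3.
move=> q t k b t1; elim=> {q t k b t1} [q t b Eb|q t q' k b t1 Eq _ IH] t' Et.
  have := Hs q t'; rewrite Et => -[E1 E2 E3].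
  exists (sweep (iq q) t').2; split=> //.
  have Ef := Hf (sweep q t).1; rewrite Eb -E1 in Ef.
  case Er: (ret b) Ef => [q'|b'] Ef; last exact: exec_stop.
  by move=> k2 b2 t2; exact: exec_next.
have := Hs q t'; rewrite Et => -[E1 E2 E3].
have [t1' [F1 F2 F3]] := IH _ E2.
exists t1'; split=> //; first by rewrite F2.
have Ef := Hf (sweep q t).1; rewrite Eq -E1 in Ef.
case Er: (ret b) F3 => [q2|b'] F3; last exact: exec_next F3.
by move=> k2 b2 t2 /F3; exact: exec_next.
Qed.

Lemma testable_map (G G' : finType) (h : G' -> G) (R : seq G -> bool -> Prop) :
  testable R -> testable (fun w => R (map h w)).
Proof.
move=> [M [f [pf H]]].
pose M' := @Sweeper G' (aux M) (aux0 M) (sst M) (sst0 M)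
   (fun q g x => sread q (h g) x) (@sfin _ M).
exists M', f; split=> // w b Rb t Et.
pose pi (c : G' * aux M') : G * aux M := (h c.1, c.2).
have [|k [t' [He lek]]] := H _ _ Rb (map pi t).
  by rewrite -Et -!map_comp.
have [||t1 [_ _ Ht]] := @exec_sim _ _ M M' id inr pi unit (fun=> tt) _ _ _ _ _ _ _ He t erefl.
- by move=> q g' x' /=; case: (sread q (h g') x') => q1 x1 /=; exists x1.
- by move=> q /=; case: (sfin q).
by exists k, t1; rewrite size_map in lek.
Qed.

Lemma testable_if (G : finType) (R1 R2 R3 : seq G -> bool -> Prop) :
  testable R1 -> testable R2 -> testable R3 ->
  testable (fun w b => exists b1, R1 w b1 /\ if b1 then R2 w b else R3 w b).
Proof.
move=> [M1 [f1 [p1 H1]]] [M2 [f2 [p2 H2]]] [M3 [f3 [p3 H3]]].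
pose A := (aux M1 * (aux M2 * aux M3))%type.
pose Q := (sst M1 + (sst M2 + sst M3))%type.
pose rd (s : Q) (g : G) (x : A) : Q * A :=
  match s with
  | inl q => let: (q1, y) := sread q g x.1 in (inl q1, (y, x.2))
  | inr (inl q) => let: (q1, y) := sread q g x.2.1 in (inr (inl q1), (x.1, (y, x.2.2)))
  | inr (inr q) => let: (q1, y) := sread q g x.2.2 in (inr (inr q1), (x.1, (x.2.1, y)))
  end.
pose fi (s : Q) : Q + bool :=
  match s with
  | inl q => match sfin q with
             | inl q1 => inl (inl q1)
             | inr b => inl (inr (if b then inl (sst0 M2) else inr (sst0 M3)))
             end
  | inr (inl q) => match sfin q with inl q1 => inl (inr (inl q1)) | inr b => inr b end
  | inr (inr q) => match sfin q with inl q1 => inl (inr (inr q1)) | inr b => inr b end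
  end.
pose M := @Sweeper G A (aux0 M1, (aux0 M2, aux0 M3)) Q (inl (sst0 M1)) rd fi.
exists M, (fun n => f1 n + (f2 n + f3 n)); split=> [|w b [b1 [Rb1 Rb]] t Et].
  by apply: poly_bounded_add => //; exact: poly_bounded_add.
pose pi1 (c : G * aux M) : G * aux M1 := (c.1, c.2.1).
pose pi2 (c : G * aux M) : G * aux M2 := (c.1, c.2.2.1).
pose pi3 (c : G * aux M) : G * aux M3 := (c.1, c.2.2.2).
have [|k [t' [He lek]]] := H1 _ _ Rb1 (map pi1 t); first by rewrite -map_comp.
have [||t1 [_ F1 Ht]] := @exec_sim _ _ M1 M inl (fun b => inl
  (inr (if b then inl (sst0 M2) else inr (sst0 M3)))) pi1 G fst _ _ _ _ _ _ _ He t erefl.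
- move=> q g' [x1 x23] /=; case: (sread q g' x1) => q1 y /=.
  by exists (y, x23).
- by move=> q /=.
have {}F1 : map fst t1 = w by rewrite -Et.
move: Ht Rb He Rb1; case: b1 => Ht Rb He Rb1.
  have [|k2 [t2 [He2 lek2]]] := H2 _ _ Rb (map pi2 t1); first by rewrite -map_comp.
  have [||t3 [_ _ Ht2]] := @exec_sim _ _ M2 M (inr \o inl) inr
     pi2 G fst _ _ _ _ _ _ _ He2 t1 erefl.
  - move=> q g' [x1 [x2 x3]] /=; case: (sread q g' x2) => q1 y /=.
    by exists (x1, (y, x3)).
  - by move=> q /=.
  exists (k + k2), t3; split; first exact: Ht Ht2.
  by rewrite leq_add // (leq_trans lek2) // leq_addr.
have [|k2 [t2 [He2 lek2]]] := H3 _ _ Rb (map pi3 t1); first by rewrite -map_comp.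
have [||t3 [_ _ Ht2]] := @exec_sim _ _ M3 M (inr \o inr) inr
   pi3 G fst _ _ _ _ _ _ _ He2 t1 erefl.
- move=> q g' [x1 [x2 x3]] /=; case: (sread q g' x3) => q1 y /=.
  by exists (x1, (x2, y)).
- by move=> q /=.
exists (k + k2), t3; split; first exact: Ht Ht2.
by rewrite leq_add // (leq_trans lek2) // leq_addl.
Qed.

Lemma mkseq_cons (T : Type) (h : nat -> T) n :
  mkseq h n.+1 = h 0 :: mkseq (h \o succn) n.
Proof. by rewrite /mkseq /= (iotaDl 1 0) -map_comp. Qed.

Definition prev_cell (T : Type) (p : option T) (h : nat -> T) (i : nat) : option T :=
  if i is j.+1 then Some (h j) else p.

(* A loop keeps a word over [X] next to the input.  A round runs a test, rewrites
   every cell as a function of the answer, of the cell and of its left neighbour,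
   and leaves the loop according to [stop]. *)
Lemma testable_loop (G X : finType) (g0 : G) (x0 : X) (init : option G -> G -> X)
    (upd : bool -> option (G * X) -> G * X -> X)
    (stop : bool -> option (G * X) -> bool)
    (R1 R2 : seq (G * X) -> bool -> Prop) (R : seq G -> bool -> Prop)
    (I : nat -> (nat -> G * X) -> bool -> nat -> Prop) (f : nat -> nat) :
  testable R1 -> testable R2 -> poly_bounded f ->
  (forall n g b, R (mkseq g n) b -> exists2 m, m <= f n &
     I n (fun i => (g i, init (prev_cell None g i) (g i))) b m) ->
  (forall n h b m, I n h b m -> exists2 b1, R1 (mkseq h n) b1 &
     let h' i := ((h i).1, upd b1 (prev_cell None h i) (h i)) in
     if stop b1 (prev_cell None h n) then R2 (mkseq h' n) b
     else exists2 m', m' < m & I n h' b m') ->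
  testable R.
Proof.
move=> [M1 [f1 [p1 H1]]] [M2 [f2 [p2 H2]]] pf Iinit Istep.
pose A := (X * (aux M1 * aux M2))%type.
pose Q := ((option G + sst M1) + ((bool * option (G * X)) + sst M2))%type.
pose rd (s : Q) (g : G) (x : A) : Q * A :=
  match s with
  | inl (inl p) => (inl (inl (Some g)), (init p g, x.2))
  | inl (inr q) => let: (q1, y) := sread q (g, x.1) x.2.1 in
                   (inl (inr q1), (x.1, (y, x.2.2)))
  | inr (inl (b, p)) => (inr (inl (b, Some (g, x.1))), (upd b p (g, x.1), x.2))
  | inr (inr q) => let: (q1, y) := sread q (g, x.1) x.2.2 in
                   (inr (inr q1), (x.1, (x.2.1, y)))
  end.
pose fi (s : Q) : Q + bool :=
  match s with
  | inl (inl _) => inl (inl (inr (sst0 M1)))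
  | inl (inr q) => match sfin q with
                   | inl q1 => inl (inl (inr q1))
                   | inr b => inl (inr (inl (b, None)))
                   end
  | inr (inl (b, p)) => inl (if stop b p then inr (inr (sst0 M2)) else inl (inr (sst0 M1)))
  | inr (inr q) => match sfin q with inl q1 => inl (inr (inr q1)) | inr b => inr b end
  end.
pose M := @Sweeper G A (x0, (aux0 M1, aux0 M2)) Q
                   (inl (inl None)) rd fi.
pose px (c : G * aux M) : G * X := (c.1, c.2.1).
have Sinit n g p t : map fst t = mkseq g n ->
    (sweep (inl (inl p) : sst M) t).1 = inl (inl (prev_cell p g n)) /\
    map px (sweep (inl (inl p) : sst M) t).2 =
      mkseq (fun i => (g i, init (prev_cell p g i) (g i))) n.
  elim: n g p t => [|n IH] g p [|[a y] t] //=.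
  rewrite mkseq_cons => -[-> /IH] /(_ (Some (g 0))).
  case: (sweep _ _) => q1 t1 /= [-> E]; split; first by case: n {IH E}.
  rewrite mkseq_cons E; congr cons; apply: eq_mkseq => i /=.
  by case: i.
have Supd n h b p t : map px t = mkseq h n ->
    (sweep (inr (inl (b, p)) : sst M) t).1 = inr (inl (b, prev_cell p h n)) /\
    map px (sweep (inr (inl (b, p)) : sst M) t).2 =
      mkseq (fun i => ((h i).1, upd b (prev_cell p h i) (h i))) n.
  elim: n h p t => [|n IH] h p [|[a y] t] //=.
  rewrite mkseq_cons => -[E0 /IH] /(_ (Some (h 0))).
  rewrite /px /= in E0; rewrite E0.
  case: (sweep _ _) => q1 t1 /= [-> E]; split; first by case: n {IH E}.
  rewrite mkseq_cons E -E0; congr cons; apply: eq_mkseq => i /=.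
  by case: i => //=; rewrite E0.
pose pi1 (c : G * aux M) : (G * X) * aux M1 := ((c.1, c.2.1), c.2.2.1).
pose pi2 (c : G * aux M) : (G * X) * aux M2 := ((c.1, c.2.1), c.2.2.2).
(* [m] exceeds the variant, hence bounds the number of rounds; a round costs one test and one
   updating sweep. *)
have main n h b m m0 : I n h b m0 -> m0 < m ->
    forall t, map px t = mkseq h n ->
    exists k t', exec (inl (inr (sst0 M1)) : sst M) t k b t' /\
      k <= m * (f1 n).+1 + f2 n.
  elim: m m0 h => // m IH m0 h Ih le0 t Et.
  have [b1 Rb1 Hs] := Istep _ _ _ _ Ih.
  have [|k [t' [He lek]]] := H1 _ _ Rb1 (map pi1 t); first by rewrite -map_comp.
  have [||t1 [_ F1 Ht]] := @exec_sim _ _ M1 M (inl \o inr)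
    (fun b => inl (inr (inl (b, None)))) pi1 (G * X)%type px _ _ _ _ _ _ _ He t erefl.
  - move=> q g' [y [y1 y2]] /=; case: (sread q (g', y) y1) => q1 z /=.
    by exists (y, (z, y2)).
  - by move=> q /=.
  rewrite Et in F1; rewrite size_mkseq in lek; move: Ht Hs => /= Ht.
  have [Eu1 Eu2] := Supd _ _ b1 None _ F1.
  rewrite /= in Eu2.
  case: ifP => [Es Rb|Es [m' lt' Ih']].
    have [|k2 [t2 [He2 lek2]]] := H2 _ _ Rb (map pi2 (sweep (inr (inl (b1, None)) : sst M) t1).2).
      by rewrite -map_comp; exact: Eu2.
    have [||t3 [_ _ Ht2]] := @exec_sim _ _ M2 M (inr \o inr) inr
      pi2 G fst _ _ _ _ _ _ _ He2 _ erefl.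
    - move=> q g' [y [y1 y2]] /=; case: (sread q (g', y) y2) => q1 z /=.
      by exists (y, (y1, z)).
    - by move=> q /=.
    rewrite size_mkseq in lek2.
    exists (k + k2.+1), t3; split; last by lia.
    apply: Ht; apply: exec_next Ht2.
    by rewrite Eu1 /= Es.
  have [|k2 [t2 [He2 lek2]]] := IH _ _ Ih' _ _ Eu2; first by rewrite (leq_trans lt').
  exists (k + k2.+1), t2; split; last by lia.
  by apply: Ht; apply: exec_next He2; rewrite Eu1 /= Es.
exists M, (fun n => 1 + (f n + 1) * (f1 n + 1) + f2 n); split.
  by do ?[apply: poly_bounded_add => // | apply: poly_bounded_mul => //];
     exact: poly_bounded_const.
move=> w b Rb t Et; rewrite -(mkseq_nth g0 w) in Rb Et; set n := size w in Rb Et *.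
have [E1 E2] := Sinit _ _ None _ Et.
have [m lem Im] := Iinit _ _ _ Rb.
have [|k [t' [He lek]]] := main n _ _ (f n).+1 _ Im _ _ E2; first exact: lem.
exists k.+1, t'; split; last by rewrite !addn1; lia.
by apply: exec_next He; rewrite E1.
Qed.

Lemma testable_of_in_P (G : finType) (L : seq G -> Prop) (b : seq G -> bool) :
  testable (fun w c => c = b w) -> (forall w, b w <-> L w) -> in_P L.
Proof.
move=> [M [f [[c [d Hf]] H]]] Hb; apply: (@in_P_of_sweeper _ M _ c d) => w.
have [|k [t' [He lek]]] := H w _ erefl (map (fun g => (g, aux0 M)) w).
  by rewrite -map_comp map_id.
by exists k, (b w), t'; split=> //; rewrite (leq_trans lek).
Qed.

Lemma testable_const (G : finType) c : testable (fun (w : seq G) b => b = c).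
Proof. exact: (@testable_dfa G unit (fun q _ => q) tt (fun=> c)). Qed.

Lemma testable_neg (G : finType) (R : seq G -> bool -> Prop) :
  testable R -> testable (fun w b => R w (~~ b)).
Proof.
move=> tR; apply: testable_sub (testable_if tR (testable_const G false) (testable_const G true)).
by move=> w b Rb; exists (~~ b); split=> //; case: b Rb.
Qed.

Lemma testable_and (G : finType) (R1 R2 : seq G -> bool -> Prop) :
  testable R1 -> testable R2 ->
  testable (fun w b => exists b1 b2, [/\ R1 w b1, R2 w b2 & b = b1 && b2]).
Proof.
move=> t1 t2; apply: testable_sub (testable_if t1 t2 (testable_const G false)).
by move=> w b [b1 [b2 [Hb1 Hb2 ->]]]; exists b1; split=> //; case: b1 Hb1.
Qed.

Lemma testable_or (G : finType) (R1 R2 : seq G -> bool -> Prop) :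
  testable R1 -> testable R2 ->
  testable (fun w b => exists b1 b2, [/\ R1 w b1, R2 w b2 & b = b1 || b2]).
Proof.
move=> t1 t2; apply: testable_sub (testable_if t1 (testable_const G true) t2).
by move=> w b [b1 [b2 [Hb1 Hb2 ->]]]; exists b1; split=> //; case: b1 Hb1.
Qed.

Lemma testable_has (G : finType) (P : pred G) : testable (fun w b => b = has P w).
Proof.
apply: testable_sub (@testable_dfa G bool (fun q g => q || P g) false id).
move=> w b -> {b}; rewrite -[LHS]/(false || has P w).
by elim: w false => [|g w IH] q /=; rewrite ?orbF // -IH orbA.
Qed.

Lemma has_iota n (P : pred nat) : reflect (exists2 i, i < n & P i) (has P (iota 0 n)).
Proof.
by apply: (iffP hasP) => -[i]; [rewrite mem_iota|]; exists i => //; rewrite mem_iota.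
Qed.

Lemma has_mkseq (T : Type) (P : pred T) (h : nat -> T) n :
  has P (mkseq h n) = has (P \o h) (iota 0 n).
Proof. by rewrite /mkseq has_map. Qed.

Lemma has_mark (T : Type) (P : pred T) (M : pred nat) (h : nat -> T) n p :
  (forall i, i < n -> M i = (i == p)) ->
  has (fun i => M i && P (h i)) (iota 0 n) = (p < n) && P (h p).
Proof.
move=> HM; apply/has_iota/andP => [[i lti]|[ltp Pp]].
  by rewrite HM // => /andP[/eqP <-].
by exists p; rewrite // HM // eqxx.
Qed.

(** A single mark moves right until the test succeeds, and then stays in place. If it never
    succeeds, the mark falls off the last cell, so the final test only looks for a surviving
    mark. *)
Lemma testable_ex (G : finType) (g0 : G) (R : seq (G * bool) -> bool -> Prop) :
  testable R ->
  testable (fun w b => exists P : pred nat,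
    (forall p, p < size w ->
       R (mkseq (fun i => (nth g0 w i, i == p)) (size w)) (P p)) /\
    b = has P (iota 0 (size w))).
Proof.
move=> tR.
pose init (p : option G) (g : G) := p == None.
pose upd b (p : option (G * bool)) (c : G * bool) :=
  if b then c.2 else if p is Some d then d.2 else false.
pose stop b (p : option (G * bool)) := b || if p is Some d then d.2 else true.
(* The loop runs its test even on the empty word, where there is no position on which [R] could
   allow an answer. *)
pose R1 w b := if w is [::] then b = false else R w b.
have tR1 : testable R1.
  apply: testable_sub (testable_if (testable_has predT) tR (testable_const _ false)).
  move=> w b; case: w => [|c w] Rw; first by exists false.
  by exists true.
pose I n (h : nat -> G * bool) b m := exists P p,
  [/\ (forall i, i < n -> (h i).2 = (i == p)),
      (forall p, p < n -> R (mkseq (fun i => ((h i).1, i == p)) n) (P p)),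
      (forall q, q < p -> q < n -> ~~ P q), (n == 0) || (p < n) &
      b = has P (iota 0 n) /\ m = n - p].
apply: (@testable_loop _ _ g0 false init upd stop _ _ _ I succn
  tR1 (testable_has snd) poly_bounded_succ).
- move=> n g b [P [HP ->]]; rewrite size_mkseq in HP *; exists n => //.
  exists P, 0; split=> //; first by case.
  + move=> p ltp; have := HP p ltp; congr (R _ _).
    by apply/eq_in_map => i; rewrite mem_iota => /andP[_ lti]; rewrite nth_mkseq.
  + by case: n {HP}.
  + by rewrite subn0.
- move=> n h b m [P [p [Hh HP Hq np [-> ->]]]].
  case: n => [|n] in Hh HP Hq np *.
    by exists false.
  exists (P p).
    rewrite /R1 mkseq_cons -mkseq_cons; have := HP p np; congr (R _ _).
    by apply/eq_in_map => i; rewrite mem_iota => /andP[_ lti]; rewrite -Hh //; case: (h i).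
  cbv zeta; rewrite has_mkseq /stop /upd /prev_cell Hh //.
  case EP: (P p); rewrite ?orTb ?orFb.
    by apply/has_iota/has_iota; exists p => //=; rewrite Hh.
  case: eqP => [En|/eqP nEn].
    transitivity false.
      apply/negbTE/has_iota => -[q ltq Pq].
      case: (ltngtP q p) => [ltqp|ltpq|Eq]; first by have := Hq q ltqp ltq; rewrite Pq.
        by move: ltpq; rewrite -En ltnNge -ltnS ltq.
      by rewrite -Eq Pq in EP.
    apply/esym/negbTE/has_iota => -[[|i] //= lti].
    by rewrite Hh; [rewrite -En => /eqP Ei; rewrite Ei ltnn in lti | exact: ltnW].
  have ltpn : p.+1 < n.+1 by move: np nEn; lia.
  exists (n.+1 - p.+1); first by lia.
  exists P, p.+1; split=> //.
  + by move=> [|i] lti //=; rewrite Hh // ltnW.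
  + by move=> q; rewrite ltnS leq_eqVlt => /orP[/eqP->|ltq] ltqn; rewrite ?EP ?Hq.
Qed.

(** * Queries on the positions of a word *)

Definition letter_at (s : seq symbol) (i : nat) : symbol := nth (Clause) s i.

Definition update (e : nat -> nat) (j p : nat) : nat -> nat :=
  fun k => if k == j then p else e k.

Definition marked (m : nat) (s : seq symbol) (e : nat -> nat) :
    seq (symbol * {ffun 'I_m -> bool}) :=
  mkseq (fun i => (letter_at s i, [ffun j : 'I_m => i == e j])) (size s).

(** The word shows only the first [m] variables. A definable [phi] cannot depend on the others,
    since two environments with the same marks would require two answers of one deterministic
    machine. *)
Definition definable (m : nat) (phi : seq symbol -> (nat -> nat) -> bool) : Prop :=
  testable (fun w b => exists s e,
    [/\ forall j, e j < size s, w = marked m s e & b = phi s e]).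

Lemma definable_neg m phi : definable m phi -> definable m (fun s e => ~~ phi s e).
Proof.
move=> /testable_neg; apply: testable_sub => w b [s [e [He -> ->]]].
by exists s, e; rewrite negbK.
Qed.

Lemma definable_and m phi psi :
  definable m phi -> definable m psi -> definable m (fun s e => phi s e && psi s e).
Proof.
move=> d1 d2; apply: testable_sub (testable_and d1 d2) => w b [s [e [He -> ->]]].
by exists (phi s e), (psi s e); split=> //; exists s, e.
Qed.

Definition automaton (Q : Type) (delta : Q -> symbol -> bool -> bool -> Q) (q0 : Q)
    (s : seq symbol) (p q : nat) : Q :=
  foldl (fun st i => delta st (letter_at s i) (i == p) (i == q)) q0 (iota 0 (size s)).

Lemma definable_automaton m (Q : finType) (delta : Q -> symbol -> bool -> bool -> Q)
    (q0 : Q) (acc : pred Q) i j :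
  i < m -> j < m ->
  definable m (fun s e => acc (automaton delta q0 s (e i) (e j))).
Proof.
move=> ltim ltjm.
apply: testable_sub (testable_dfa (fun st (c : symbol * {ffun 'I_m -> bool}) =>
   delta st c.1 (c.2 (Ordinal ltim)) (c.2 (Ordinal ltjm))) q0 acc).
move=> w b [s [e [He -> ->]]]; congr acc; rewrite /automaton /marked /mkseq.
by elim: (iota _ _) q0 => //= k l IH q0; rewrite !ffunE IH.
Qed.

Definition set_mark m j (c : (symbol * {ffun 'I_m -> bool}) * bool) :
    symbol * {ffun 'I_m -> bool} :=
  (c.1.1, [ffun k : 'I_m => if k == j :> nat then c.2 else c.1.2 k]).

Lemma update_lt (e : nat -> nat) j p n :
  (forall k, e k < n) -> p < n -> forall k, update e j p k < n.
Proof. by move=> He ltp k; rewrite /update; case: eqP. Qed.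

Lemma set_markE m s (e : nat -> nat) j p i :
  set_mark j ((letter_at s i, [ffun k : 'I_m => i == e k]), i == p) =
  (letter_at s i, [ffun k : 'I_m => i == update e j p k]).
Proof.
congr pair; apply/ffunP=> k; rewrite !ffunE /update.
by case: (k == j :> nat).
Qed.

Lemma definable_ex m phi j :
  definable m phi ->
  definable m (fun s e => has (fun p => phi s (update e j p)) (iota 0 (size s))).
Proof.
move=> /(testable_map (@set_mark m j)).
move=> /(testable_ex (Clause, [ffun=> false])).
apply: testable_sub => w b [s [e [He -> ->]]].
rewrite /marked size_mkseq; exists (fun p => phi s (update e j p)); split=> // p ltp.
exists s, (update e j p); split=> //; first exact: update_lt.
rewrite /marked -map_comp; apply/eq_in_map => i; rewrite mem_iota => /andP[_ lti] /=.
by rewrite nth_mkseq // set_markE.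
Qed.

(** * Comparison of two runs of bits *)

Definition bit_of (c : symbol) : option bool := if c is Bit b then Some b else None.

Fixpoint bit_prefix (s : seq symbol) : seq bool :=
  if s is Bit b :: s' then b :: bit_prefix s' else [::].

(* The two words are read together as long as [r] holds; [fin] is told which of them have
   a bit left. *)
Fixpoint lockstep (r : rel bool) (fin : bool -> bool -> bool) (u v : seq bool) : bool :=
  match u, v with
  | b :: u', c :: v' => if r b c then lockstep r fin u' v' else fin true true
  | _, _ => fin (u != [::]) (v != [::])
  end.

Lemma bit_prefix_drop s p :
  bit_prefix (drop p s) =
  if p < size s then
    if letter_at s p is Bit b then b :: bit_prefix (drop p.+1 s) else [::]
  else [::].
Proof.
case: ltnP => [ltp|lep]; last by rewrite drop_oversize.
by rewrite (drop_nth Clause ltp) /=; rewrite -/(letter_at s p).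
Qed.

(** One left-to-right pass with finite memory cannot compare two distant runs of bits. Here two
    marks advance by one cell per round, and each round tests the two letters under them. *)
Lemma definable_lockstep m (r : rel bool) fin (di dj : bool) i j :
  i < m -> j < m ->
  definable m (fun s e => lockstep r fin (bit_prefix (drop (di + e i) s))
                                         (bit_prefix (drop (dj + e j) s))).
Proof.
move=> ltim ltjm.
pose G : finType := (symbol * {ffun 'I_m -> bool})%type.
(* With an offset, the initial mark is copied from the left neighbour, which skips the letter
   preceding the bits. *)
pose at0 (d : bool) (k : 'I_m) (p : option G) (g : G) :=
  if d then (if p is Some g' then g'.2 k else false) else g.2 k.
pose init (p : option G) (g : G) := (at0 di (Ordinal ltim) p g, at0 dj (Ordinal ltjm) p g).
pose upd b (p : option (G * (bool * bool))) (c : G * (bool * bool)) :=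
  if b then (if p is Some d then d.2 else (false, false)) else c.2.
pose stop b (_ : option (G * (bool * bool))) := ~~ b.
pose reads (k : bool) (P : option bool -> bool) (c : G * (bool * bool)) :=
  (if k then c.2.2 else c.2.1) && P (bit_of c.1.1).
pose test (w : seq (G * (bool * bool))) := has (fun b1 : bool =>
   has (reads false (pred1 (Some b1))) w &&
   has (reads true (fun o => if o is Some b2 then r b1 b2 else false)) w) [:: true; false].
have t1 : testable (fun w b => b = test w).
  have tb b1 := testable_and (testable_has (reads false (pred1 (Some b1))))
    (testable_has (reads true (fun o => if o is Some b2 then r b1 b2 else false))).
  apply: testable_sub (testable_or (tb true) (tb false)) => w b ->.
  by rewrite /test /= orbF; do 2!eexists; split; last by []; do 2!eexists; split.
pose final (w : seq (G * (bool * bool))) :=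
  fin (has (reads false isSome) w) (has (reads true isSome) w).
have t2 : testable (fun w b => b = final w).
  have tl := testable_has (reads false isSome).
  have tr := testable_has (reads true isSome).
  apply: testable_sub (testable_if tl
    (testable_if tr (testable_const _ (fin true true)) (testable_const _ (fin true false)))
    (testable_if tr (testable_const _ (fin false true)) (testable_const _ (fin false false)))).
  move=> w b ->; exists (has (reads false isSome) w); split=> //; rewrite /final.
  by case: (has (reads false _) w); exists (has (reads true isSome) w);
    case: (has (reads true _) w).
pose I n (h : nat -> G * (bool * bool)) b k := exists s p q,
  [/\ size s = n, (forall i, i < n -> (h i).1.1 = letter_at s i /\ (h i).2 = (i == p, i == q)),
      b = lockstep r fin (bit_prefix (drop p s)) (bit_prefix (drop q s)) & k = n - p].
apply: (@testable_loop _ _ (Clause, [ffun=> false]) (false, false) init upd stop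
  _ _ _ I id t1 t2).
- exact: poly_bounded_leq poly_bounded_succ.
- move=> n g b [s [e [He Eg ->]]].
  have En : n = size s by have := congr1 size Eg; rewrite !size_mkseq.
  have Egi k : k < n -> g k = (letter_at s k, [ffun j : 'I_m => k == e j]).
    move=> ltk; rewrite -(nth_mkseq (Clause, [ffun=> false]) g ltk) Eg nth_mkseq //.
    by rewrite -En.
  exists (n - (di + e i)); first exact: leq_subr.
  exists s, (di + e i), (dj + e j); split=> // k ltk; rewrite Egi //; split=> //=.
  rewrite /init /at0; congr pair.
    case Ed: (di); rewrite ?ffunE //; case: k ltk => //= k ltk.
    by rewrite Egi ?ffunE //= ltnW.
  case Ed: (dj); rewrite ?ffunE //; case: k ltk => //= k ltk.
  by rewrite Egi ?ffunE //= ltnW.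
move=> n h b k [s [p [q [Es Hh -> ->]]]].
(* A mark pushed past the last cell has vanished, and this reads as the end of its run of bits. *)
have R1 P : has (reads false P) (mkseq h n) = (p < n) && P (bit_of (letter_at s p)).
  rewrite has_mkseq -(@has_mark _ (P \o bit_of) (fun i => i == p) (letter_at s)) //.
  by apply: eq_in_has => i0; rewrite mem_iota => /andP[_ /Hh] [] /=; rewrite /reads => -> ->.
have R2 P : has (reads true P) (mkseq h n) = (q < n) && P (bit_of (letter_at s q)).
  rewrite has_mkseq -(@has_mark _ (P \o bit_of) (fun i => i == q) (letter_at s)) //.
  by apply: eq_in_has => i0; rewrite mem_iota => /andP[_ /Hh] [] /=; rewrite /reads => -> ->.
exists (test (mkseq h n)) => //; rewrite /stop.
have Et : test (mkseq h n) = [&& p < n, q < n &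
    if (bit_of (letter_at s p), bit_of (letter_at s q)) is (Some b1, Some b2)
    then r b1 b2 else false].
  rewrite /test /= !R1 !R2 orbF.
  case: (p < n) => //=; case: (q < n) => /=; rewrite ?andbF ?orbF //.
  case: (letter_at s p) => [[]||] //=; case: (letter_at s q) => [[]||] //=;
  by rewrite ?andbF ?orbF.
case: ifP => Eb.
  have Eu i0 : ((h i0).1, upd (test (mkseq h n)) (prev_cell None h i0) (h i0)) = h i0.
    by rewrite /upd (negbTE Eb); case: (h i0).
  rewrite /final (eq_mkseq Eu) R1 R2.
  rewrite (bit_prefix_drop s p) (bit_prefix_drop s q) Es.
  move: Eb; rewrite Et.
  case: (p < n) => //=; case: (q < n) => //=;
  case: (letter_at s p) => [b1||] //=; case: (letter_at s q) => [b2||] //=.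
  by case: (r b1 b2).
move: Et; rewrite (negbFE Eb) => /esym/and3P[ltp ltq Hr].
exists (n - p.+1); first by lia.
exists s, p.+1, q.+1; split=> //.
  move=> i0 lti; have [E1 E2] := Hh _ lti; split; first exact: E1.
  rewrite /upd [LHS]/=.
  case: i0 lti {E1 E2} => //= i0 lti; by have [|_ ->] := Hh i0; first exact: ltnW.
rewrite (bit_prefix_drop s p) (bit_prefix_drop s q) Es ltp ltq.
move: Hr; case: (letter_at s p) => [b1||] //=; case: (letter_at s q) => [b2||] //=.
by move=> ->.
Qed.

(** * Reachability in a definable graph *)

Definition reachable (n : nat) (r : rel nat) (x y : nat) : bool :=
  [exists i : 'I_n, [exists j : 'I_n, [&& i == x :> nat, j == y :> nat &
     connect (fun i' j' : 'I_n => r i' j') i j]]].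

Lemma reachable_refl n r x : x < n -> reachable n r x x.
Proof.
move=> ltx; apply/existsP; exists (Ordinal ltx); apply/existsP; exists (Ordinal ltx).
by rewrite /= !eqxx connect0.
Qed.

Lemma reachable_trans n r x y z :
  reachable n r x y -> reachable n r y z -> reachable n r x z.
Proof.
move=> /existsP[i /existsP[j /and3P[/eqP Ei /eqP Ej Hij]]].
move=> /existsP[k /existsP[l /and3P[/eqP Ek /eqP El Hkl]]].
apply/existsP; exists i; apply/existsP; exists l; rewrite Ei El !eqxx /=.
by apply: connect_trans Hij _; rewrite (_ : j = k) //; apply: val_inj; rewrite /= Ej.
Qed.

Lemma reachable1 n (r : rel nat) x y : x < n -> y < n -> r x y -> reachable n r x y.
Proof.
move=> ltx lty Hr; apply/existsP; exists (Ordinal ltx); apply/existsP; exists (Ordinal lty).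
by rewrite /= !eqxx connect1.
Qed.

Lemma reachable_ind n (r : rel nat) (S : pred nat) x y :
  (forall i j, i < n -> j < n -> r i j -> S i -> S j) ->
  reachable n r x y -> S x -> S y.
Proof.
move=> HS /existsP[i /existsP[j /and3P[/eqP <- /eqP <- /connectP[p]]]].
elim: p i => [|k p IH] i /=; first by move=> _ ->.
by move=> /andP[Hr Hp] Ej Si; apply: IH Hp Ej _; exact: HS Hr Si.
Qed.

(** The reached set grows by one position at a time, each addition sending the candidate back to the
    first cell. When the candidate fails on the last cell, the set is closed under edges. *)
Lemma definable_reachable m phi a b c d :
  c < m -> d < m -> definable m phi ->
  definable m (fun s e => reachable (size s)
     (fun x y => phi s (update (update e a x) b y)) (e c) (e d)).
Proof.
move=> ltcm ltdm dphi.
pose G : finType := (symbol * {ffun 'I_m -> bool})%type.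
pose X : finType := (bool * bool)%type.
pose g0 : G := (Clause, [ffun=> false]).
pose init (p : option G) (g : G) := (g.2 (Ordinal ltcm), p == None).
pose upd t (p : option (G * X)) (h : G * X) : X := if t then (h.2.1 || h.2.2, p == None)
   else (h.2.1, if p is Some h' then h'.2.2 else false).
pose stop t (p : option (G * X)) := ~~ t && (if p is Some h then h.2.2 else true).
pose marks2 (h : (G * X) * bool) : G := set_mark b (set_mark a (h.1.1, h.2), h.1.2.2).
have t1 := testable_and (testable_has (fun h : G * X => h.2.2 && ~~ h.2.1))
  (testable_ex (g0, (false, false)) (testable_and
    (testable_has (fun h : (G * X) * bool => h.2 && h.1.2.1))
    (testable_map marks2 dphi))).
have t2 := testable_has (fun h : G * X => h.1.2 (Ordinal ltdm) && h.2.1).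
pose r s (e : nat -> nat) x y := phi s (update (update e a x) b y).
(* [S] is the reached set and [p] the candidate; no edge from [S] to a position below [p] leaves
   [S]. The variant is lexicographic: unreached positions, then candidates left. *)
pose I n (h : nat -> G * X) t k := exists s (e : nat -> nat) (S : pred nat) (p : nat),
  [/\ size s = n, forall j, e j < n,
      forall i, i < n -> h i = ((letter_at s i, [ffun j : 'I_m => i == e j]), (S i, i == p)),
      t = reachable n (r s e) (e c) (e d) &
      [/\ p < n, S (e c), (forall x, x < n -> S x -> reachable n (r s e) (e c) x),
          (forall x y, x < n -> y < p -> S x -> r s e x y -> S y) &
          k = (n - count S (iota 0 n)) * n.+1 + (n - p)]].
apply: (@testable_loop _ _ g0 (false, false) init upd stop _ _ _ I
          (fun n => n.+1 * n.+1) t1 t2).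
- by apply: poly_bounded_mul; exact: poly_bounded_succ.
- move=> n g t [s [e [He Eg ->]]].
  have En : n = size s by have := congr1 size Eg; rewrite !size_mkseq.
  rewrite -En in He.
  have Egi k : k < n -> g k = (letter_at s k, [ffun j : 'I_m => k == e j]).
    move=> ltk; rewrite -(nth_mkseq (Clause, [ffun=> false]) g ltk) Eg nth_mkseq //.
    by rewrite -En.
  exists ((n - count (fun i => i == e c) (iota 0 n)) * n.+1 + n).
    by rewrite mulSn addnC leq_add ?leqnSn ?leq_mul2r ?leq_subr ?orbT.
  exists s, e, (fun i => i == e c), 0; split; rewrite -?En //.
    move=> i lti; rewrite Egi // /init /= ffunE; congr (_, (_, _)).
    by case: i lti.
  split=> //; last by rewrite subn0.
  + exact: leq_ltn_trans (He 0).
  + by move=> x ltx /eqP ->; exact: reachable_refl.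
move=> n h t k [s [e [S [p [Es He Hh -> [ltp Sc Sr Scl ->]]]]]].
pose t1' := ~~ S p && has (fun x => S x && r s e x p) (iota 0 n).
exists t1'.
  exists (~~ S p), (has (fun x => S x && r s e x p) (iota 0 n)); split=> //.
    rewrite has_mkseq; transitivity (has (fun i => (i == p) && ~~ S i) (iota 0 n)).
      by rewrite (@has_mark _ (predC S) (fun i => i == p) id n p) //= ltp.
    by apply: eq_in_has => i; rewrite mem_iota => /andP[_ lti]; rewrite /= Hh.
  rewrite size_mkseq; exists (fun x => S x && r s e x p); split=> // x ltx.
  exists (S x), (r s e x p); split=> //.
    rewrite has_mkseq; transitivity (has (fun i => (i == x) && S i) (iota 0 n)).
      by rewrite (@has_mark _ S (fun i => i == x) id n x) //= ltx.
    apply: eq_in_has => i; rewrite mem_iota => /andP[_ lti].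
    by rewrite /= nth_mkseq // Hh.
  exists s, (update (update e a x) b p); rewrite Es; split=> //.
    by do 2!apply: update_lt => //.
  rewrite /marked Es -map_comp; apply/eq_in_map => i; rewrite mem_iota => /andP[_ lti].
  by rewrite /= nth_mkseq // Hh // /marks2 /= !set_markE.
have lt0n : 0 < n by exact: leq_ltn_trans ltp.
rewrite /stop; case: ifP => [/andP[nt Hlast]|].
  have Ep : p.+1 = n.
    move: Hlast; rewrite /prev_cell; case: (n) lt0n Hh => // n' _ Hh.
    by rewrite Hh //= => /eqP ->.
  rewrite has_mkseq.
  transitivity (S (e d)); last first.
    rewrite -[LHS]andTb -(He d) -[LHS](@has_mark _ S (fun i => i == e d) id) //=.
    apply: eq_in_has => i; rewrite mem_iota => /andP[_ lti].
    by rewrite /= Hh //= ffunE /upd (negbTE nt).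
  apply/idP/idP => [Hre|]; last exact: Sr.
  apply: reachable_ind Hre Sc => i j lti ltj Hr Si.
  move: ltj; rewrite -Ep ltnS leq_eqVlt => /orP[/eqP Ej|ltj]; last exact: Scl Hr.
  move: nt; rewrite Ej in Hr *; rewrite negb_and negbK => /orP[//|].
  by move=> /has_iota[]; exists i => //; rewrite Si.
move=> Hns.
have hfst i : i < n -> (h i).1 = (letter_at s i, [ffun j : 'I_m => i == e j]).
  by move=> /Hh ->.
case Et: t1' Hns => /= Hlast.
  have /andP[nSp /has_iota[x ltx /andP[Sx rx]]] := Et.
  pose S' i := S i || (i == p).
  have cS : count S' (iota 0 n) = (count S (iota 0 n)).+1.
    have := count_predUI S (pred1 p) (iota 0 n).
    rewrite count_uniq_mem ?iota_uniq // mem_iota /= add0n ltp addn1.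
    rewrite (_ : count (predI _ _) _ = 0) ?addn0.
      by move=> <-; apply: eq_count.
    apply/eqP; rewrite -leqn0 leqNgt -has_count; apply/has_iota => -[i _ /= /andP[Si /eqP Ei]].
    by rewrite -Ei Si in nSp.
  have leS : count S' (iota 0 n) <= n.
    by rewrite -[X in _ <= X](size_iota 0) count_size.
  exists ((n - count S' (iota 0 n)) * n.+1 + (n - 0)).
    rewrite cS subn0; rewrite cS in leS.
    rewrite -[n - count S _](@subnK 1) ?subn_gt0 // mulnDl mul1n -subnDA addn1.
    by rewrite -addnA ltn_add2l addSn ltnS leq_addr.
  exists s, e, S', 0; split=> //.
    move=> i lti; rewrite hfst // /upd Hh //=; congr (_, (_, _)).
    by case: i lti.
  split=> //; first by rewrite /S' Sc.
  move=> y lty /orP[|/eqP->]; first exact: Sr.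
  by apply: reachable_trans (Sr x ltx Sx) _; exact: reachable1.
have ltp1 : p.+1 < n.
  move: Hlast; rewrite /prev_cell; case: (n) lt0n ltp Hh => // n' _ ltp' Hh.
  by rewrite Hh //= => /eqP nE; lia.
exists ((n - count S (iota 0 n)) * n.+1 + (n - p.+1)); first by rewrite ltn_add2l; lia.
exists s, e, S, p.+1; split=> //.
  move=> i lti; rewrite hfst // /upd Hh //=; congr (_, (_, _)).
  by case: i lti => //= i lti; rewrite Hh // ltnW.
split=> // x y ltx; rewrite ltnS leq_eqVlt => /orP[/eqP->|lty] Sx Hr; last exact: Scl Hr.
move/negbT: Et; rewrite negb_and negbK => /orP[//|].
by move=> /has_iota[]; exists x => //; rewrite Sx.
Qed.

(* Variables are numbers, and the value of a variable is a position of the word;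
   [FReach a b f c d] says that [d] is reachable from [c] in the graph whose edges
   are the pairs [(a, b)] satisfying [f]. *)
Inductive query : Type :=
| FAuto (Q : finType) (delta : Q -> symbol -> bool -> bool -> Q) (q0 : Q) (acc : pred Q)
    (i j : nat)
| FLock (r : rel bool) (fin : bool -> bool -> bool) (di dj : bool) (i j : nat)
| FNeg (f : query)
| FAnd (f g : query)
| FEx (j : nat) (f : query)
| FReach (a b : nat) (f : query) (c d : nat).

Fixpoint eval (f : query) (s : seq symbol) (e : nat -> nat) : bool :=
  match f with
  | FAuto Q delta q0 acc i j => acc (automaton delta q0 s (e i) (e j))
  | FLock r fin di dj i j => lockstep r fin (bit_prefix (drop (di + e i) s))
                                            (bit_prefix (drop (dj + e j) s))
  | FNeg f => ~~ eval f s e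
  | FAnd f g => eval f s e && eval g s e
  | FEx j f => has (fun p => eval f s (update e j p)) (iota 0 (size s))
  | FReach a b f c d => reachable (size s)
      (fun x y => eval f s (update (update e a x) b y)) (e c) (e d)
  end.

(** Only variables that are read are counted: a quantified variable that nothing reads needs no mark
    on the cells. *)
Fixpoint query_bound (f : query) : nat :=
  match f with
  | FAuto _ _ _ _ i j => maxn i.+1 j.+1
  | FLock _ _ _ _ i j => maxn i.+1 j.+1
  | FNeg f => query_bound f
  | FAnd f g => maxn (query_bound f) (query_bound g)
  | FEx _ f => query_bound f
  | FReach _ _ f c d => maxn (query_bound f) (maxn c.+1 d.+1)
  end.

Lemma definable_query m f : query_bound f <= m -> definable m (eval f).
Proof.
elim: f => /= [Q delta q0 acc i j|r fin di dj i j|f IH|f IHf g IHg|j f IH|a b f IH c d].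
- by rewrite geq_max => /andP[? ?]; exact: definable_automaton.
- by rewrite geq_max => /andP[? ?]; exact: definable_lockstep.
- by move/IH/definable_neg.
- by rewrite geq_max => /andP[/IHf ? /IHg ?]; exact: definable_and.
- by move/IH/definable_ex => /(_ j).
- by rewrite !geq_max => /and3P[/IH ? ? ?]; exact: definable_reachable.
Qed.

(* The variables of a query are positions, of which the empty word has none. *)
Lemma testable_query f : testable (fun w b => b = (w == [::]) || eval f w (fun=> 0)).
Proof.
pose m := query_bound f.
have t1 := @definable_query m f (leqnn _).
pose X : finType := {ffun 'I_m -> bool}.
pose init (p : option symbol) (_ : symbol) : X := [ffun=> p == None].
have t2 := testable_map (fun h : symbol * X => h) t1.
pose I n (h : nat -> symbol * X) b (k : nat) := exists s,
  [/\ n = size s, 0 < n, forall i, i < n -> h i = (letter_at s i, [ffun=> i == 0]) &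
      b = eval f s (fun=> 0)].
have tl : testable (fun w b => w <> [::] /\ b = eval f w (fun=> 0)).
  apply: (@testable_loop _ _ Clause [ffun=> false] init (fun _ _ h => h.2)
    (fun _ _ => true) _ _ _ I (fun=> 0) (testable_const _ true) t2 (poly_bounded_const _)).
  - move=> n g b [Hw Hb]; exists 0 => //; exists (mkseq g n); rewrite size_mkseq; split=> //.
      by case: n Hw {Hb}.
    move=> i lti; congr pair; first by rewrite /letter_at nth_mkseq.
    by apply/ffunP=> j; rewrite !ffunE; case: i {lti}.
  - move=> n h b k [s [En lt0 Hh ->]]; exists true => //=.
    exists s, (fun=> 0); split=> //; first by rewrite -En.
    rewrite map_id /marked -En; apply/eq_in_map => i; rewrite mem_iota => /andP[_ lti].
    by rewrite Hh.
apply: testable_sub (testable_if (testable_has predT) tl (testable_const _ true)).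
move=> w b ->; exists (has predT w); split=> //.
by case: w.
Qed.

Definition FOr f g := FNeg (FAnd (FNeg f) (FNeg g)).
Definition FImp f g := FNeg (FAnd f (FNeg g)).
Definition FAll j f := FNeg (FEx j (FNeg f)).
Definition FTrue := FAuto (fun (q : unit) _ _ _ => q) tt predT 0 0.
Definition FConj (l : seq query) := foldr FAnd FTrue l.
Definition FDisj (l : seq query) := FNeg (FConj (map FNeg l)).

Lemma eval_FOr f g s e : eval (FOr f g) s e = eval f s e || eval g s e.
Proof. by rewrite /= negb_and !negbK. Qed.

Lemma eval_FImp f g s e : eval (FImp f g) s e = (eval f s e ==> eval g s e).
Proof. by rewrite /= negb_and negbK implybE. Qed.

Lemma eval_FAll j f s e :
  eval (FAll j f) s e = all (fun p => eval f s (update e j p)) (iota 0 (size s)).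
Proof. by rewrite /= -all_predC; apply: eq_all => p /=; rewrite negbK. Qed.

Lemma eval_FConj l s e : eval (FConj l) s e = all (fun f => eval f s e) l.
Proof. by elim: l => //= f l ->. Qed.

Lemma eval_FDisj l s e : eval (FDisj l) s e = has (fun f => eval f s e) l.
Proof.
by rewrite /FDisj [LHS]/= eval_FConj all_map -has_predC; apply: eq_has => f /=; rewrite negbK.
Qed.

Arguments eval : simpl never.

Definition valid_env (s : seq symbol) (e : nat -> nat) : Prop := forall k, e k < size s.

Lemma valid_update s e j p : valid_env s e -> p < size s -> valid_env s (update e j p).
Proof. exact: update_lt. Qed.

Lemma eval_FNeg f s e : eval (FNeg f) s e = ~~ eval f s e.
Proof. by []. Qed.

Lemma eval_FAnd f g s e : eval (FAnd f g) s e = eval f s e && eval g s e.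
Proof. by []. Qed.

Lemma eval_FEx j f (P : pred nat) s e : valid_env s e ->
  (forall p, p < size s -> valid_env s (update e j p) -> eval f s (update e j p) = P p) ->
  eval (FEx j f) s e = has P (iota 0 (size s)).
Proof.
move=> He HP; apply: eq_in_has => p; rewrite mem_iota => /andP[_ ltp].
by apply: HP => //; exact: valid_update.
Qed.

Lemma eval_FAll_eq j f (P : pred nat) s e : valid_env s e ->
  (forall p, p < size s -> valid_env s (update e j p) -> eval f s (update e j p) = P p) ->
  eval (FAll j f) s e = all P (iota 0 (size s)).
Proof.
move=> He HP; rewrite eval_FAll; apply: eq_in_all => p; rewrite mem_iota => /andP[_ ltp].
by apply: HP => //; exact: valid_update.
Qed.

(** * Elementary queries *)

Definition FLetter (P : pred symbol) i :=
  FAuto (fun (q : bool) c mi _ => q || (mi && P c)) false id i i.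
Definition FSamePos i j :=
  FAuto (fun (q : bool) _ mi mj => q || (mi && mj)) false id i j.
Definition FFirst i :=
  FAuto (fun (q : option bool) _ mi _ => if q is Some _ then q else Some mi) None
    (pred1 (Some true)) i i.
Definition is_clause (c : symbol) := if c is Clause then true else false.
Definition is_literal (c : symbol) := if c is Literal _ then true else false.

(* The two first components tell whether the positions have been passed. *)
Definition FSame (P : pred symbol) i j :=
  FAuto (fun (q : bool * bool * bool) c mi mj =>
           (q.1.1 || mi, q.1.2 || mj, q.2 && ~~ ((q.1.1 != q.1.2) && P c)))
    (false, false, true) (fun q => q.2) i j.

(** The position itself is counted, so for [is_clause] a clause letter has the same rank as the
    literals of its clause, and rank 0 means before the first clause. *)
Definition rank (P : pred symbol) (s : seq symbol) (i : nat) : nat :=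
  count P (take i.+1 s).

Lemma eval_FLetter P i s e : valid_env s e ->
  eval (FLetter P i) s e = P (letter_at s (e i)).
Proof.
move=> He; have lti := He i; rewrite /eval /automaton.
transitivity (has (fun k => (k == e i) && P (letter_at s k)) (iota 0 (size s))).
  by rewrite -[RHS]orFb; elim: (iota _ _) false => [|k l IH] q /=; rewrite ?orbF // IH orbA.
by rewrite (@has_mark _ P (fun k => k == e i) _ _ (e i)) // lti.
Qed.

Lemma eval_FSamePos i j s e : valid_env s e ->
  eval (FSamePos i j) s e = (e i == e j).
Proof.
move=> He; have lti := He i; rewrite /eval /automaton.
transitivity (has (fun k => (k == e i) && (k == e j)) (iota 0 (size s))).
  by rewrite -[RHS]orFb; elim: (iota _ _) false => [|k l IH] q /=; rewrite ?orbF // IH orbA.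
by rewrite (@has_mark _ (fun k => k == e j) (fun k => k == e i) id _ (e i)) // lti.
Qed.

Lemma eval_FFirst i s e : valid_env s e -> eval (FFirst i) s e = (e i == 0).
Proof.
move=> He; have := He i; rewrite /FFirst /eval /automaton; case: (size s) => // n _ /=.
set F := (X in foldl X _ _). have -> l b : foldl F (Some b) l = Some b by elim: l.
by rewrite [RHS]eq_sym; case: (0 == e i).
Qed.

Lemma rank_mono P s i j : i <= j -> rank P s i <= rank P s j.
Proof.
move=> leij; rewrite /rank -(subnKC leij) -addSn takeD count_cat leq_addr //.
Qed.

(** The letters counted by one rank and not by the other lie after the smaller position and up to
    the larger one, that is, where exactly one flag is already set when they are read. *)
Lemma eval_FSame P i j s e : valid_env s e ->
  eval (FSame P i j) s e = (rank P s (e i) == rank P s (e j)).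
Proof.
move=> He; have lti := He i; have ltj := He j; rewrite /FSame /eval /automaton.
set delta := fun _ _ => _.
pose c p k := count P (take (minn p.+1 k) s).
have cS p k : k < size s ->
    c p k.+1 = c p k + ((k <= p) && P (letter_at s k)).
  move=> ltk; rewrite /c minnSS; case: leqP => [lekp|ltpk].
    rewrite (minn_idPr _) ?ltnS // 1?leqW // (take_nth Clause ltk).
    by rewrite -cats1 count_cat /= addn0.
  by rewrite (minn_idPl _) ?addn0 // ?(minn_idPl _) //; exact: ltnW.
have cle p q k : p <= q -> c p k <= c q k.
  move=> lepq; have lem : minn p.+1 k <= minn q.+1 k.
    by rewrite leq_min geq_minr andbT geq_min ltnS lepq.
  by rewrite /c -(subnKC lem) takeD count_cat leq_addr.
have main k : k <= size s -> foldl delta (false, false, true) (iota 0 k) =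
    (e i < k, e j < k, c (e i) k == c (e j) k).
  elim: k => [|k IH] ltk; first by rewrite /c !minn0 eqxx.
  rewrite -addn1 iotaD foldl_cat IH; last exact: ltnW.
  rewrite [LHS]/= {1}/delta [LHS]/= add0n addn1 !cS // !ltnS.
  rewrite ![k <= _]leqNgt (leq_eqVlt (e i) k) (leq_eqVlt (e j) k).
  rewrite !(eq_sym k) ![(_ < k) || _]orbC.
  congr (_, _, _).
  case: (P _); last by rewrite !andbF !addn0 andbT.
  rewrite !andbT.
  case: (ltnP (e i) k) => ltik; case: (ltnP (e j) k) => ltjk /=;
    rewrite ?addn0 ?andbT ?addn1 ?eqSS //.
    rewrite andbF; apply/esym/negbTE; rewrite neq_ltn ltnS cle //.
    by rewrite (leq_trans (ltnW ltik)).
  rewrite andbF; apply/esym/negbTE; rewrite neq_ltn ltnS cle ?orbT //.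
  by rewrite (leq_trans (ltnW ltjk)).
by rewrite main // /c !(minn_idPl _).
Qed.

(** * Binary numbers *)

Definition bits (m : nat) : seq bool :=
  if bin_of_nat m is Npos p then bits_of_pos p else [::].

Definition bits_value (u : seq bool) : nat := foldr (fun (b : bool) v => b + v.*2) 0 u.

Definition canonical_bits (u : seq bool) : bool := last true u.

Lemma encode_natE m : encode_nat m = map Bit (bits m).
Proof. by rewrite /encode_nat /bits; case: bin_of_nat. Qed.

Lemma bits_value_bits m : bits_value (bits m) = m.
Proof.
rewrite /bits; have := bin_of_natK m; case: (bin_of_nat m) => [|p] <- //=.
elim: p => [p /= ->|p /= ->|] //=; rewrite ?NatTrec.doubleE //.
Qed.

Lemma canonical_bits_bits m : canonical_bits (bits m).
Proof.
rewrite /canonical_bits /bits; case: bin_of_nat => //= p.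
by elim: p true => //= p IH b; apply: IH.
Qed.

Lemma bits_value_lt u : bits_value u < 2 ^ size u.
Proof. by elim: u => //= -[] u IH; rewrite expnS; lia. Qed.

Lemma bits_value_ge c u : canonical_bits (c :: u) -> 2 ^ size u <= bits_value (c :: u).
Proof.
rewrite /canonical_bits /=; elim: u c => [|d u IH] c /= H; first by rewrite H.
by have := IH d H; rewrite expnS; set x := 2 ^ _; lia.
Qed.

Lemma bits_value_inj u v : canonical_bits u -> canonical_bits v ->
  bits_value u = bits_value v -> u = v.
Proof.
elim: u v => [|b u IH] [|c v] //=.
- by move=> _ /bits_value_ge /= H E; move: H; rewrite -E leqn0 expn_eq0.
- by move=> /bits_value_ge /= H _ E; move: H; rewrite E leqn0 expn_eq0.
move=> cu cv E; have Ebc : b = c by case: b c E {cu cv} => [] [] //=; lia.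
rewrite Ebc in E cu *; congr cons; apply: IH; last by lia.
- by case: (u) cu.
- by case: (v) cv.
Qed.

Lemma bits_bits_value u : canonical_bits u -> bits (bits_value u) = u.
Proof.
move=> cu; apply: bits_value_inj => //; first exact: canonical_bits_bits.
exact: bits_value_bits.
Qed.

Lemma bits_inj : injective bits.
Proof. by move=> m n E; rewrite -(bits_value_bits m) E bits_value_bits. Qed.

Lemma bits_value_lt_size u v : canonical_bits v -> size u < size v ->
  bits_value u < bits_value v.
Proof.
have := bits_value_lt u; case: v => [|c v] // lt1 /bits_value_ge ge1 lt2.
by apply: leq_trans lt1 (leq_trans _ ge1); rewrite leq_pexp2l.
Qed.

Lemma bits_value_cat u v :
  bits_value (u ++ v) = bits_value u + 2 ^ size u * bits_value v.
Proof. by elim: u => [|b u IH] /=; rewrite ?mul1n // IH expnS; lia. Qed.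

Lemma bits_value_inj_size u v : size u = size v -> bits_value u = bits_value v -> u = v.
Proof.
elim: u v => [|b u IH] [|c v] //= [Es] E.
have Ebc : b = c by case: b c E => [] [] //=; lia.
by rewrite Ebc in E *; congr cons; apply: IH Es _; lia.
Qed.

(** Least significant digits come first, so the last difference decides, and [t] is the common block
    of higher digits. *)
Lemma bits_value_lt_same u v : size u = size v ->
  bits_value u < bits_value v <->
  exists u1 v1 t, u = u1 ++ false :: t /\ v = v1 ++ true :: t.
Proof.
move=> Es; split.
  elim: u v Es => [|b u IH] [|c v] //= [Es] Hlt.
  case: (ltngtP (bits_value u) (bits_value v)) => H.
  - by have [u1 [v1 [t [-> ->]]]] := IH _ Es H; exists (b :: u1), (c :: v1), t.
  - by case: b c Hlt => [] []; lia.
  exists [::], [::], u; rewrite (bits_value_inj_size Es H) in Hlt *.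
  by case: b c Hlt => [] [] //=; lia.
move=> [u1 [v1 [t [Eu Ev]]]]; rewrite Eu Ev !bits_value_cat /=.
have -> : size v1 = size u1.
  by move: Es; rewrite Eu Ev !size_cat /=; lia.
have := bits_value_lt u1; set x := 2 ^ _; set y := bits_value t; nia.
Qed.

Definition is_bit (c : symbol) := if c is Bit _ then true else false.

Lemma lockstep_eq u v :
  lockstep (fun b c => b == c) (fun x y => ~~ x && ~~ y) u v = (u == v).
Proof.
elim: u v => [|b u IH] [|c v] //=; rewrite eqseq_cons.
by case: (b == c) => /=; rewrite ?IH.
Qed.

Lemma lockstep_size_lt u v :
  lockstep (fun _ _ => true) (fun x y => ~~ x && y) u v = (size u < size v).
Proof. by elim: u v => [|b u IH] [|c v] //=; rewrite IH. Qed.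

Lemma lockstep_size_eq u v :
  lockstep (fun _ _ => true) (fun x y => ~~ x && ~~ y) u v = (size u == size v).
Proof. by elim: u v => [|b u IH] [|c v] //=; rewrite IH. Qed.

(** Rank 0 for the letters that are not bits places [p] inside the initial run of bits; ranks are
    how a query locates a digit of a number. *)
Lemma bit_prefix_split s p b :
  p < size s -> rank (predC is_bit) s p = 0 -> letter_at s p = Bit b ->
  bit_prefix s = take p (bit_prefix s) ++ b :: bit_prefix (drop p.+1 s).
Proof.
elim: s p => [|c s IH] [|p] //=; rewrite ?drop0.
  by move=> _ _; rewrite /letter_at /= => ->.
rewrite ltnS => ltp; rewrite /rank /=; case: c => [b'||] //= Hr El.
by congr cons; apply: IH.
Qed.

Lemma bit_prefix_cat s u b v :
  bit_prefix s = u ++ b :: v ->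
  [/\ size u < size s, rank (predC is_bit) s (size u) = 0,
      letter_at s (size u) = Bit b & bit_prefix (drop (size u).+1 s) = v].
Proof.
elim: u s => [|c u IH] [|[b'||] s] //= [-> E].
  by rewrite /rank /= take0 drop0.
by have [H1 H2 H3 H4] := IH s E; split.
Qed.

Lemma rank_drop P s z p : z < size s -> z < p ->
  rank P s p = rank P s z + rank P (drop z.+1 s) (p - z.+1).
Proof.
move=> ltz ltzp; rewrite /rank.
have -> : p.+1 = z.+1 + (p - z.+1).+1 by lia.
by rewrite takeD count_cat.
Qed.

Lemma rank_gt0 (P : pred symbol) s i :
  i < size s -> P (letter_at s i) -> 0 < rank P s i.
Proof.
by move=> lti Pi; rewrite /rank (take_nth Clause lti) -cats1 count_cat /= Pi addn1.
Qed.

Lemma letter_at_drop s z p : z < p -> letter_at s p = letter_at (drop z.+1 s) (p - z.+1).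
Proof. by move=> ltzp; rewrite /letter_at nth_drop subnKC. Qed.

(** After a literal letter, these bits are the index of its variable. Equality of keys thus stands
    for equality of variables, with no need to compute the index. *)
Definition key (s : seq symbol) (z : nat) : seq bool := bit_prefix (drop z.+1 s).

Definition FKeyEq i j := FLock (fun b c => b == c) (fun x y => ~~ x && ~~ y) true true i j.

Lemma eval_FKeyEq i j s e : eval (FKeyEq i j) s e = (key s (e i) == key s (e j)).
Proof. exact: lockstep_eq. Qed.

(* Every index is less than the number of variables.  As the least significant bit comes
   first, a number is smaller than another one if it is shorter, or if it has the same
   length and the two have the same bits after some positions [2] and [3] where they
   have the bits 0 and 1. *)
Definition FNumberLt :=
  FAll 0 (FImp (FLetter is_literal 0) (FEx 1 (FAnd (FFirst 1) (FOr
    (FLock (fun _ _ => true) (fun x y => ~~ x && y) true false 0 1)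
    (FAnd (FLock (fun _ _ => true) (fun x y => ~~ x && ~~ y) true false 0 1)
      (FEx 2 (FEx 3 (FConj
        [:: FLetter is_bit 1; FSame (predC is_bit) 0 2; FLetter (pred1 (Bit false)) 2;
            FSame (predC is_bit) 1 3; FLetter (pred1 (Bit true)) 3; FKeyEq 2 3])))))))).

Lemma eval_FNumberLt s e : valid_env s e ->
  canonical_bits (bit_prefix s) ->
  (forall z, z < size s -> is_literal (letter_at s z) -> canonical_bits (key s z)) ->
  eval FNumberLt s e =
  all (fun z => is_literal (letter_at s z) ==> (bits_value (key s z) < bits_value (bit_prefix s)))
    (iota 0 (size s)).
Proof.
move=> He cs ck; apply: eval_FAll_eq => // z ltz Hz.
rewrite eval_FImp eval_FLetter // [update e 0 z 0]/=.
case lz: (is_literal _) => //; rewrite !implyTb.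
have {}ck := ck z ltz lz.
set v := bit_prefix s in cs *; set u := key s z in ck *.
transitivity (has (fun h => (h == 0) && ((size u < size v) || ((size u == size v) &&
   has (fun p => has (fun q => [&& is_bit (letter_at s 0),
      rank (predC is_bit) s z == rank (predC is_bit) s p,
      letter_at s p == Bit false, rank (predC is_bit) s 0 == rank (predC is_bit) s q,
      letter_at s q == Bit true & key s p == key s q]) (iota 0 (size s))) (iota 0 (size s)))))
  (iota 0 (size s))).
  apply: eval_FEx => // h lth Hh.
  rewrite eval_FAnd eval_FFirst // (_ : update (update e 0 z) 1 h 1 = h) //.
  case: eqP => [Eh|//]; rewrite !andTb eval_FOr eval_FAnd; congr (_ || (_ && _)).
  - by rewrite /eval lockstep_size_lt /update /= Eh drop0.
  - by rewrite /eval lockstep_size_eq /update /= Eh drop0.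
  apply: eval_FEx => // p ltp Hp; apply: eval_FEx => // q ltq Hq.
  by rewrite eval_FConj /= !eval_FLetter // !eval_FSame // eval_FKeyEq /update /= Eh andbT.
have lt0 : 0 < size s by exact: leq_ltn_trans ltz.
apply/has_iota/idP => [[h _ /andP[_ /orP[lts|/andP[/eqP Es]]]]|ltuv].
- exact: bits_value_lt_size.
- move=> /has_iota[p ltp /has_iota[q ltq]].
  move=> /and5P[b0 /eqP rzp /eqP lp /eqP r0q /andP[/eqP lq /eqP Epq]].
  (* Equal ranks do not order the positions: if [p] came first, the literal letter at [z], not being
     a bit, would make the ranks differ. *)
  have ltzp : z < p.
    case: (ltngtP z p) => // [ltpz|Ezp]; last by rewrite Ezp lp in lz.
    have := rank_drop (predC is_bit) ltp ltpz; rewrite rzp => /eqP.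
    rewrite -[X in X == _]addn0 eqn_add2l => /eqP E0.
    have : 0 < rank (predC is_bit) (drop p.+1 s) (z - p.+1).
      apply: rank_gt0; first by rewrite size_drop; lia.
      by rewrite -letter_at_drop //; case: (letter_at s z) lz.
    by rewrite -E0.
  have Eu : u = take (p - z.+1) u ++ false :: key s p.
    rewrite {1}/u /key (@bit_prefix_split (drop z.+1 s) (p - z.+1) false).
    + by rewrite drop_drop -/(key s z); congr (_ ++ _ :: bit_prefix (drop _ _)); lia.
    + by rewrite size_drop; lia.
    + have := rank_drop (predC is_bit) ltz ltzp; rewrite -rzp => /eqP.
      by rewrite -[X in X == _]addn0 eqn_add2l => /eqP.
    + by rewrite -letter_at_drop.
  (* The word starts with a bit, so its first position has rank 0, and an equal rank puts [q] in the
     leading number. *)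
  have Ev : v = take q v ++ true :: key s q.
    rewrite {1}/v (@bit_prefix_split s q true) // -r0q.
    rewrite /rank (take_nth Clause) // take0 /= addn0.
    by move: b0; rewrite /letter_at => ->.
  by apply/(bits_value_lt_same Es); rewrite Eu Ev Epq; eauto.
exists 0 => //=; case: (ltngtP (size u) (size v)) => //= Es.
  by have := bits_value_lt_size ck Es; lia.
have [u1 [v1 [t [Eu Ev]]]] := (bits_value_lt_same Es).1 ltuv.
have [Hu1 Hu2 Hu3 Hu4] := bit_prefix_cat Eu.
have [Hv1 Hv2 Hv3 Hv4] := bit_prefix_cat Ev.
rewrite size_drop in Hu1; have ltp : z.+1 + size u1 < size s by lia.
apply/has_iota; exists (z.+1 + size u1) => //; apply/has_iota; exists (size v1) => //.
have ltzp : z < z.+1 + size u1 by lia.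
rewrite (rank_drop _ ltz ltzp) (letter_at_drop s ltzp) addKn Hu2 addn0 Hu3 Hv3 !eqxx /=.
have r0 : rank (predC is_bit) s 0 <= 0 by rewrite -[X in _ <= X]Hv2; exact: rank_mono.
rewrite Hv2 -leqn0 r0 /key Hv4 -addnS [z.+1 + _]addnC -drop_drop Hu4 eqxx !andbT.
move: r0; rewrite /rank (take_nth Clause) // take0 /= addn0 /letter_at.
by case: (is_bit _).
Qed.

(** * Reading a formula in a word *)

Definition raw_literal : Type := (bool * seq bool)%type.
Definition raw_word : Type := (seq bool * seq raw_literal * seq (seq raw_literal))%type.

(* [raw_of s] is made of the leading bits of [s], of the literals before its first
   clause letter, and of its clauses; it fails if a bit follows a clause letter. *)
Fixpoint raw_of (s : seq symbol) : option raw_word :=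
  match s with
  | [::] => Some ([::], [::], [::])
  | Bit b :: s => if raw_of s is Some (u, ls, cs) then Some (b :: u, ls, cs) else None
  | Literal b :: s =>
    if raw_of s is Some (u, ls, cs) then Some ([::], (b, u) :: ls, cs) else None
  | Clause :: s =>
    if raw_of s is Some ([::], ls, cs) then Some ([::], [::], ls :: cs) else None
  end.

Definition word_of_literal (l : raw_literal) : seq symbol := Literal l.1 :: map Bit l.2.
Definition word_of_clause (c : seq raw_literal) : seq symbol :=
  Clause :: flatten (map word_of_literal c).

Lemma raw_ofP s u ls cs : raw_of s = Some (u, ls, cs) ->
  s = map Bit u ++ flatten (map word_of_literal ls) ++ flatten (map word_of_clause cs).
Proof.
elim: s u ls cs => [|[b|b|] s IH] u ls cs /=; first by case=> <- <- <-.
- by case: (raw_of s) IH => // -[[u' ls'] cs'] /(_ _ _ _ erefl) -> [<- <- <-].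
- by case: (raw_of s) IH => // -[[u' ls'] cs'] /(_ _ _ _ erefl) -> [<- <- <-] /=; rewrite -catA.
- case: (raw_of s) IH => // -[[[|//] ls'] cs'] /(_ _ _ _ erefl) -> [<- <- <-] //=.
Qed.

Lemma raw_of_bits u s ls cs : raw_of s = Some ([::], ls, cs) ->
  raw_of (map Bit u ++ s) = Some (u, ls, cs).
Proof. by move=> E; elim: u => //= b u ->. Qed.

Lemma raw_of_literals ls s cs : raw_of s = Some ([::], [::], cs) ->
  raw_of (flatten (map word_of_literal ls) ++ s) = Some ([::], ls, cs).
Proof.
move=> E; elim: ls => [|[b u] ls IH] //=.
by rewrite -catA (raw_of_bits _ IH).
Qed.

Lemma raw_of_clauses cs : raw_of (flatten (map word_of_clause cs)) = Some ([::], [::], cs).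
Proof. by elim: cs => //= c cs IH; rewrite (raw_of_literals _ IH). Qed.

Definition raw_literal_of n (l : literal n) : raw_literal := (l.2, bits l.1).

Lemma raw_of_cnf n (phi : cnf n) :
  raw_of (encode_cnf phi) = Some (bits n, [::], map (map (@raw_literal_of n)) phi).
Proof.
rewrite /encode_cnf encode_natE; apply: raw_of_bits.
rewrite -[RHS]raw_of_clauses -map_comp; congr (raw_of (flatten _)).
apply: eq_map => c; rewrite /encode_clause /word_of_clause /= -map_comp.
by congr (_ :: flatten _); apply: eq_map => l; rewrite /encode_literal encode_natE.
Qed.

Definition canonical_clause (c : seq raw_literal) : bool :=
  (size c <= 3) && all (fun l : raw_literal => canonical_bits l.2) c.

(* The state records the number of literals of the current clause, if any, and
   whether the next letter must be a bit ([Some true]) or cannot be ([None]). *)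
Definition format_state : Type := option (option 'I_4 * option bool).

Definition format_step (q : format_state) (c : symbol) : format_state :=
  if q is Some (k, l) then
    match c with
    | Bit b => if l == None then None else Some (k, Some (~~ b))
    | Literal _ => if l == Some true then None else
       if k is Some j then if j < 3 then Some (Some (inord j.+1), Some false) else None
       else None
    | Clause => if l == Some true then None else Some (Some ord0, None)
    end
  else None.

Definition format_accept (q : format_state) : bool :=
  if q is Some (_, l) then l != Some true else false.

(** The condition on an unread suffix for acceptance from the state [(k, l)]: [u] continues the
    number being read and [ls] the current clause. This generality is what the induction on the
    suffix needs. *)
Definition raw_format (k : option 'I_4) (l : option bool) (r : option raw_word) : bool :=
  if r is Some (u, ls, cs) then
    [&& (l == None) ==> (u == [::]), (l == Some true) ==> (u != [::]), canonical_bits u,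
        (if k is Some j then size ls + j <= 3 else ls == [::]),
        all (fun l : raw_literal => canonical_bits l.2) ls & all canonical_clause cs]
  else false.

Lemma format_stepP s k l :
  format_accept (foldl format_step (Some (k, l)) s) = raw_format k l (raw_of s).
Proof.
have none t : format_accept (foldl format_step None t) = false by elim: t.
elim: s k l => [|[b|b|] s IH] k l.
- by rewrite /raw_format /=; case: l => [[]|]; case: k => [[[|[|[|[]]]] ?]|].
- rewrite [foldl _ _ _]/= [raw_of _]/=; case: l => [l|] /=; last first.
    by rewrite none; case: (raw_of s) => // -[[u ls] cs].
  rewrite IH /raw_format; case: (raw_of s) => // -[[u ls] cs] /=.
  by rewrite implybT /canonical_bits /=; case: b => //=; case: u.
- rewrite [foldl _ _ _]/= [raw_of _]/=; case: (l =P Some true) => [->|nl].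
    by rewrite none; case: (raw_of s) => // -[[u ls] cs].
  have Hl us : raw_format k l (Some ([::], us.1, us.2)) =
    [&& (if k is Some j then size us.1 + j <= 3 else us.1 == [::]),
        all (fun l : raw_literal => canonical_bits l.2) us.1 & all canonical_clause us.2].
    by rewrite /raw_format /=; case: l nl => [[]|].
  case: k Hl => [j|] Hl; last first.
    by rewrite none; case: (raw_of s) => // -[[u ls] cs]; rewrite (Hl ((b, u) :: ls, cs)).
  case: ltnP => ltj3.
    rewrite IH; case: (raw_of s) => // -[[u ls] cs]; rewrite (Hl ((b, u) :: ls, cs)).
    rewrite /raw_format /= inordK // addnS addSn.
    by case: (canonical_bits u) => //=; rewrite andbF.
  rewrite none; case: (raw_of s) => // -[[u ls] cs]; rewrite (Hl ((b, u) :: ls, cs)) /=.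
  by apply/esym/negbTE; rewrite negb_and -ltnNge addSn ltnS (leq_trans ltj3) ?leq_addl.
- rewrite [foldl _ _ _]/= [raw_of _]/=; case: (l =P Some true) => [->|nl].
    by rewrite none; case: (raw_of s) => // -[[[|? u] ls] cs].
  rewrite IH /raw_format; case: (raw_of s) => // -[[[|b u] ls] cs] //=.
  rewrite addn0 /canonical_clause andbA; case: l nl => [[]|] //= _;
  by case: k => [[j ltj]|] //=; rewrite ?add0n (ltj : j <= 3).
Qed.

Definition FFormat :=
  FAuto (fun q c _ _ => format_step q c) (Some (None, Some false)) format_accept 0 0.

Lemma eval_FFormat s e : eval FFormat s e = raw_format None (Some false) (raw_of s).
Proof.
rewrite -format_stepP /FFormat /eval /automaton; congr format_accept.
rewrite -[in RHS](mkseq_nth Clause s) /mkseq -/(letter_at s).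
by elim: (iota _ _) (Some _) => //= i l IH q; rewrite IH.
Qed.

Definition literal_sign (c : symbol) : bool := if c is Literal b then b else false.

Definition literal_at (s : seq symbol) (z : nat) : raw_literal :=
  (literal_sign (letter_at s z), key s z).

Definition literals_of_clause (s : seq symbol) (r : nat) : seq nat :=
  [seq z <- iota 0 (size s) | is_literal (letter_at s z) && (rank is_clause s z == r)].

Definition clause_positions (s : seq symbol) : seq nat :=
  [seq k <- iota 0 (size s) | is_clause (letter_at s k)].

Lemma literals_of_clause_cons c s r :
  literals_of_clause (c :: s) r =
  (if is_literal c && (r == 0) then [:: 0] else [::]) ++
  (if is_clause c then if r is r'.+1 then map succn (literals_of_clause s r') else [::]
   else map succn (literals_of_clause s r)).
Proof.
rewrite /literals_of_clause [iota _ _]/= (iotaDl 1 0) /= filter_map.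
have rS z : rank is_clause (c :: s) z.+1 = is_clause c + rank is_clause s z by [].
have r0 : rank is_clause (c :: s) 0 = is_clause c by rewrite /rank /= take0 /= addn0.
rewrite r0 /letter_at /= -/(letter_at s).
rewrite (@eq_filter _ (preim _ _)
   (fun z => is_literal (letter_at s z) && (is_clause c + rank is_clause s z == r))) //.
case: c {rS r0} => [b|b|] //=.
- by rewrite eq_sym; case: (r == 0).
case: r => [|r]; last by [].
rewrite -[RHS]/(map succn [::]); congr map.
by rewrite -(filter_pred0 (iota 0 (size s))); apply: eq_filter => z; rewrite andbF.
Qed.

Lemma raw_of_positions s u ls cs : raw_of s = Some (u, ls, cs) ->
  [/\ bit_prefix s = u, ls = map (literal_at s) (literals_of_clause s 0) &
      cs = [seq map (literal_at s) (literals_of_clause s (rank is_clause s k))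
             | k <- clause_positions s]].
Proof.
have shift c t l : map (literal_at (c :: t)) (map succn l) = map (literal_at t) l.
  by rewrite -map_comp.
have rS c t k : rank is_clause (c :: t) k.+1 = is_clause c + rank is_clause t k by [].
have cp c t : clause_positions (c :: t) =
    (if is_clause c then [:: 0] else [::]) ++ map succn (clause_positions t).
  rewrite /clause_positions [iota _ _]/= (iotaDl 1 0) /= filter_map.
  by rewrite /letter_at /=; case: (is_clause c).
elim: s u ls cs => [|c s IH] u ls cs; first by case=> <- <- <-.
rewrite cp literals_of_clause_cons eqxx andbT.
case: c => [b|b|] /=; case Er: (raw_of s) => [[[u' ls'] cs']|] //.
- case=> <- <- <-; have [-> E1 E2] := IH _ _ _ Er; split; rewrite ?shift //.
  rewrite -map_comp {1}E2; apply: eq_map => k /=.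
  by rewrite rS add0n literals_of_clause_cons /= shift.
- case=> <- <- <-; have [E0 E1 E2] := IH _ _ _ Er; split; rewrite ?shift //.
    by rewrite -E1 /literal_at /= /key /= drop0 E0.
  rewrite -map_comp {1}E2; apply/eq_in_map => k; rewrite mem_filter mem_iota => /and3P[ck _ ltk].
  rewrite /= rS add0n literals_of_clause_cons /=.
  by rewrite (negbTE (lt0n_neq0 (rank_gt0 ltk ck))) /= shift.
- case: u' Er => // Er [<- <- <-]; have [E0 E1 E2] := IH _ _ _ Er; split=> //.
  rewrite -map_comp {1}E2; congr (_ :: _); last first.
    apply: eq_map => k /=.
    by rewrite rS add1n literals_of_clause_cons /= shift.
  rewrite (_ : rank _ _ 0 = 1); last by rewrite /rank /= take0.
  by rewrite literals_of_clause_cons /= shift.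
Qed.

(** * Satisfaction probabilities of CNF formulas *)

Definition assign n (a : {ffun 'I_n -> bool}) (x : 'I_n) (b : bool) : {ffun 'I_n -> bool} :=
  [ffun y => if y == x then b else a y].

Definition cond n (x : 'I_n) (b : bool) (phi : cnf n) : cnf n :=
  [seq [seq l <- c | l.1 != x] | c : clause n <- phi & (x, b) \notin c].

(** Deleting literals strengthens every clause, so this approximates [phi] from below by a formula
    on the variables of [V]. *)
Definition keep n (V : seq 'I_n) (phi : cnf n) : cnf n :=
  [seq [seq l <- c | l.1 \in V] | c : clause n <- phi].

Definition tautology n (c : clause n) : bool :=
  has (fun l : literal n => (l.1, ~~ l.2) \in c) c.

Definition hits n (V : seq 'I_n) (c : clause n) : bool := has (fun l : literal n => l.1 \in V) c.

Definition prob n (phi : cnf n) : rat := ((num_sat phi)%:R / 2 ^+ n)%R.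

Lemma num_satE n (phi : cnf n) : num_sat phi = \sum_a satisfies a phi.
Proof.
rewrite /num_sat -sum1_card big_mkcond; apply: eq_bigr => a _.
by rewrite inE; case: satisfies.
Qed.

(** Flipping [x] is an involution, so each assignment with value [b] at [x] is reached from exactly
    two. *)
Lemma sum_assign n (F : {ffun 'I_n -> bool} -> nat) x b :
  \sum_a F (assign a x b) = 2 * \sum_(a : {ffun 'I_n -> bool} | a x == b) F a.
Proof.
pose flip (a : {ffun 'I_n -> bool}) := assign a x (~~ a x).
have flipK : involutive flip.
  move=> a; apply/ffunP=> y; rewrite !ffunE eqxx negbK.
  by case: eqP => // ->.
rewrite (bigID (fun a : {ffun 'I_n -> bool} => a x == b)) /= mul2n -addnn; congr (_ + _).
  apply: eq_bigr => a /eqP <-; congr F; apply/ffunP=> y; rewrite ffunE.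
  by case: eqP => // ->.
rewrite (reindex_inj (inv_inj flipK)) /=; apply: eq_big => [a|a].
  by rewrite /flip !ffunE eqxx; case: (a x) b => [] [].
rewrite /flip ffunE eqxx => /negPf nb; congr F; apply/ffunP=> y; rewrite !ffunE.
by case: eqP => // ->; case: (a x) b nb => [] [].
Qed.

Lemma satisfies_cond n (x : 'I_n) b phi a :
  satisfies a (cond x b phi) = satisfies (assign a x b) phi.
Proof.
rewrite /satisfies all_map all_filter; apply: eq_all => c /=.
case: (boolP ((x, b) \in c)) => [xbc|xbnc] /=.
  by apply/esym/hasP; exists (x, b) => //=; rewrite ffunE eqxx.
elim: c xbnc => //= -[y d] c IH; rewrite inE negb_or => /andP[nxb /IH {}IH] /=.
rewrite -IH [assign a x b y]ffunE; case: (y =P x) nxb => [->|_ _ //]; rewrite xpair_eqE eqxx /=.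
by case: b d {IH} => [] [].
Qed.

Lemma prob_cond n (x : 'I_n) phi :
  prob phi = ((prob (cond x true phi) + prob (cond x false phi)) / 2)%R.
Proof.
rewrite /prob.
have E : num_sat (cond x true phi) + num_sat (cond x false phi) = 2 * num_sat phi.
  rewrite !num_satE.
  under eq_bigr do rewrite satisfies_cond.
  under [X in _ + X]eq_bigr do rewrite satisfies_cond.
  rewrite !(sum_assign (fun a => satisfies a phi : nat)) -mulnDr; congr (2 * _).
  rewrite [RHS](bigID (fun a : {ffun 'I_n -> bool} => a x == true)) /=; congr (_ + _).
  by apply: eq_bigl => a; case: (a x).
rewrite -mulrDl -natrD E natrM; field.
by rewrite expf_neq0.
Qed.

Lemma prob_mono n (phi psi : cnf n) :
  (forall a, satisfies a phi -> satisfies a psi) -> (prob phi <= prob psi)%R.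
Proof.
move=> H; rewrite /prob ler_pM2r ?invr_gt0 ?exprn_gt0 // ler_nat /num_sat.
by apply: subset_leq_card; apply/subsetP => a; rewrite !inE; exact: H.
Qed.

Lemma prob_lt n (phi psi : cnf n) a :
  (forall a, satisfies a phi -> satisfies a psi) ->
  satisfies a psi -> ~~ satisfies a phi -> (prob phi < prob psi)%R.
Proof.
move=> H Ha na; rewrite /prob ltr_pM2r ?invr_gt0 ?exprn_gt0 // ltr_nat /num_sat.
apply: proper_card; apply/properP; split; first by apply/subsetP => b; rewrite !inE; exact: H.
by exists a; rewrite inE.
Qed.

Lemma prob_ge0 n (phi : cnf n) : (0 <= prob phi)%R.
Proof. by rewrite divr_ge0 ?exprn_ge0. Qed.

Lemma keep_mono_in n (V W : seq 'I_n) (phi : cnf n) :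
  (forall c l, c \in phi -> l \in c -> l.1 \in V -> l.1 \in W) ->
  (prob (keep V phi) <= prob (keep W phi))%R.
Proof.
move=> VW; apply: prob_mono => a /allP H; apply/allP => c' /mapP[c cphi ->].
have /hasP[l] := H _ (map_f _ cphi); rewrite mem_filter => /andP[lV lc] al.
by apply/hasP; exists l => //; rewrite mem_filter lc (VW c).
Qed.

Lemma keep_mono n (V W : seq 'I_n) phi : {subset V <= W} ->
  (prob (keep V phi) <= prob (keep W phi))%R.
Proof. by move=> VW; apply: keep_mono_in => c l _ _; exact: VW. Qed.

Lemma satisfies_keep n (V : seq 'I_n) phi a : satisfies a (keep V phi) -> satisfies a phi.
Proof.
move=> /allP H; apply/allP => c cphi.
have /hasP[l] := H _ (map_f _ cphi); rewrite mem_filter => /andP[lV lc] al.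
by apply/hasP; exists l.
Qed.

Lemma cond_keep n (x : 'I_n) b V phi : x \in V -> cond x b (keep V phi) = keep V (cond x b phi).
Proof.
move=> xV; rewrite /cond /keep filter_map -!map_comp; elim: phi => //= c phi IH.
rewrite mem_filter /= xV /=; case: ((x, b) \in c) => //=; rewrite -IH; congr (_ :: _).
by rewrite -!filter_predI; apply: eq_filter => l /=; rewrite andbC.
Qed.

Fixpoint averages (s : nat) (S : rat -> Prop) : rat -> Prop :=
  if s is s'.+1 then
    fun r => exists p q, [/\ averages s' S p, averages s' S q & r = ((p + q) / 2)%R]
  else S.

Definition spectrum (k : nat) (r : rat) : Prop :=
  exists n (phi : cnf n), is_kcnf k phi /\ r = prob phi.

Lemma averagesW s t (S : rat -> Prop) r : s <= t -> averages s S r -> averages t S r.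
Proof.
have up u p : averages u S p -> averages u.+1 S p.
  by move=> H; exists p, p; split=> //; field.
move=> /subnKC <-; elim: (t - s) => [|d IH]; first by rewrite addn0.
by move=> /IH; rewrite addnS; exact: up.
Qed.

Definition nearly_kcnf n k (V : seq 'I_n) (phi : cnf n) : bool :=
  all (fun c : clause n => (size c <= k) || (hits V c && (size c <= k.+1))) phi.

Lemma nearly_kcnf_nil n k (phi : cnf n) : nearly_kcnf k [::] phi -> is_kcnf k phi.
Proof. by apply: sub_all => c /orP[//|/andP[/hasP[]]]. Qed.

(** A surviving clause that contains [x] loses a literal; the other clauses of size k + 1 are met by
    the rest of [V]. *)
Lemma nearly_kcnf_cond n k x b V (phi : cnf n) :
  nearly_kcnf k (x :: V) phi -> nearly_kcnf k V (cond x b phi).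
Proof.
move=> /allP H; apply/allP => c' /mapP[c]; rewrite mem_filter => /andP[_ cphi] ->.
have /orP[lec|/andP[hc lec]] := H c cphi.
  by rewrite size_filter (leq_trans (count_size _ _) lec).
case: (boolP (has (fun l : literal n => l.1 == x) c)) => [hx|nhx].
  apply/orP; left; rewrite -ltnS; apply: leq_trans lec.
  rewrite size_filter -(count_predC (fun l : literal n => l.1 == x) c).
  by rewrite -add1n leq_add2r -has_count.
apply/orP; right; rewrite size_filter (leq_trans (count_size _ _) lec) andbT.
have /hasP[l lc] := hc; rewrite inE => /orP[lx|lV]; first by case/hasP: nhx; exists l.
apply/hasP; exists l => //; rewrite mem_filter lc andbT.
by apply: contra nhx => lx; apply/hasP; exists l.
Qed.

Lemma prob_averages n k V (phi : cnf n) :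
  nearly_kcnf k V phi -> averages (size V) (spectrum k) (prob phi).
Proof.
elim: V phi => [|x V IH] phi H; first by exists n, phi; split=> //; exact: nearly_kcnf_nil.
rewrite (prob_cond x) /=; do 2!eexists; split; last reflexivity.
  by apply: IH; exact: nearly_kcnf_cond.
by apply: IH; exact: nearly_kcnf_cond.
Qed.

Lemma satisfies_eq_on n (V : seq 'I_n) (phi : cnf n) (a a' : {ffun 'I_n -> bool}) :
  all (fun c : clause n => all (fun l : literal n => l.1 \in V) c) phi ->
  {in V, a =1 a'} -> satisfies a phi = satisfies a' phi.
Proof.
move=> /allP HV Eaa; apply: eq_in_all => c cphi; apply: eq_in_has => l lc.
by rewrite Eaa //; exact: (allP (HV _ cphi)).
Qed.

(* Falsifying the literals of [c] one after the other at most halves the number of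
   assignments each time, as [psi] does not depend on their variables. *)
Lemma num_sat_falsify n (V : seq 'I_n) (psi : cnf n) (c : clause n) :
  all (fun c : clause n => all (fun l : literal n => l.1 \in V) c) psi ->
  ~~ tautology c -> ~~ hits V c ->
  num_sat psi <= 2 ^ size c *
    \sum_(a : {ffun 'I_n -> bool}) (satisfies a psi && all (fun l : literal n => a l.1 != l.2) c).
Proof.
move=> HV; elim: c => [|l c IH].
  by rewrite mul1n num_satE => _ _; apply: eq_leq; apply: eq_bigr => a _; rewrite andbT.
move=> /norP[tl tc] /norP[hl hc].
apply: leq_trans (IH _ hc) _.
  apply: contra tc => /hasP[l' l'c H]; apply/hasP; exists l' => //.
  exact: (@mem_behead _ (l :: c)).
rewrite expnS [2 * _]mulnC -mulnA leq_mul2l; apply/orP; right.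
pose Q (a : {ffun 'I_n -> bool}) :=
  satisfies a psi && ((a l.1 != l.2) && all (fun l : literal n => a l.1 != l.2) c).
apply: leq_trans (_ : \sum_a (Q (assign a l.1 (~~ l.2)) : nat) <= _).
  apply: leq_sum => a _; rewrite /Q; case: (boolP (_ && _)) => //= /andP[spsi /allP ac].
  rewrite (satisfies_eq_on HV (a' := a)).
    rewrite spsi ffunE eqxx /= lt0b; apply/andP; split; first by case: (l.2).
    apply/allP => l' l'c; rewrite ffunE; case: (l'.1 =P l.1) => [E|_]; last exact: ac.
    apply/negP => /eqP El; case/negP: tl; apply: (@mem_behead _ (l :: c)).
    by rewrite El -E; case: l' l'c {E El}.
  by move=> y yV; rewrite ffunE; case: eqP => // E; rewrite -E yV in hl.
rewrite (sum_assign (fun a => Q a : nat)) leq_mul2l /=.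
rewrite [X in _ <= X](bigID (fun a : {ffun 'I_n -> bool} => a l.1 == ~~ l.2)) /=.
exact: leq_addr.
Qed.

(** The largest satisfaction probability of a nontautological clause with at most [k] literals. *)
Definition falsify_bound (k : nat) : rat := (1 - (2 ^+ k)^-1)%R.

Lemma falsify_bound_ge0 k : (0 <= falsify_bound k)%R.
Proof. by rewrite subr_ge0 invf_le1 ?exprn_gt0 // exprn_ege1. Qed.

Lemma prob_cons_disjoint n k (V : seq 'I_n) (psi : cnf n) (c : clause n) :
  all (fun c : clause n => all (fun l : literal n => l.1 \in V) c) psi ->
  ~~ tautology c -> ~~ hits V c -> size c <= k ->
  (prob (c :: psi) <= falsify_bound k * prob psi)%R.
Proof.
move=> HV tc hc lek.
have := num_sat_falsify HV tc hc; set F := (\sum_a _).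
have E : num_sat psi = num_sat (c :: psi) + F.
  rewrite !num_satE -big_split /=; apply: eq_bigr => a _.
  have -> : all (fun l : literal n => a l.1 != l.2) c =
     ~~ has (fun l : literal n => a l.1 == l.2) c by rewrite -all_predC.
  by case: (has _ c); case: (satisfies a psi).
have le2 : 2 ^ size c <= 2 ^ k by rewrite leq_pexp2l.
move=> H; have {}H : num_sat psi <= 2 ^ k * F by rewrite (leq_trans H) // leq_mul2r le2 orbT.
rewrite /prob mulrA ler_pM2r ?invr_gt0 ?exprn_gt0 // /falsify_bound mulrBl mul1r.
rewrite {1}E natrD -addrA lerDl subr_ge0 mulrC ler_pdivrMr ?exprn_gt0 //.
by rewrite mulrC -natrX -natrM ler_nat.
Qed.

(* The clauses of a maximal family of disjoint clauses are independent, and their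
   variables meet all the other clauses. *)
Lemma packing n k (phi : cnf n) :
  is_kcnf k.+1 phi -> all (predC (@tautology n)) phi ->
  exists H m, [/\ size H <= k.+1 * m, nearly_kcnf k H phi &
     (prob phi <= falsify_bound k.+1 ^+ m)%R].
Proof.
move=> kphi tphi; suff [H [m [psi [szH nH HV Hsub Hp]]]] : exists H m (psi : cnf n),
    [/\ size H <= k.+1 * m, nearly_kcnf k H phi,
     all (fun c : clause n => all (fun l : literal n => l.1 \in H) c) psi,
     {subset psi <= phi} & (prob psi <= falsify_bound k.+1 ^+ m)%R].
  exists H, m; split=> //; apply: le_trans Hp; apply: prob_mono => a /allP Ha.
  by apply/allP => c /Hsub; exact: Ha.
elim: phi kphi tphi => [|c phi IH] /=.
  exists [::], 0, [::]; split=> //; rewrite expr0 /prob ler_pdivrMr ?exprn_gt0 // mul1r.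
  rewrite -natrX ler_nat (leq_trans (max_card _)) // card_ffun card_bool card_ord //.
move=> /andP[kc kphi] /andP[tc tphi].
have [H [m [psi [szH nH HV Hsub Hp]]]] := IH kphi tphi.
(* The family is greedy: only a clause of size k + 1 with no variable in [H] joins it, and its
   variables then enter [H]. *)
case: (boolP ((size c <= k) || hits H c)) => [Hc|].
  exists H, m, psi; split=> //; last by move=> d /Hsub; rewrite inE orbC => ->.
  by rewrite /nearly_kcnf /= kc andbT Hc.
rewrite negb_or -ltnNge => /andP[ltc nh].
exists (map fst c ++ H), m.+1, (c :: psi); split.
- by rewrite size_cat size_map mulnS leq_add.
- rewrite /nearly_kcnf /= kc andbT; apply/andP; split.
    apply/orP; right; case: c ltc {kc tc nh} => //= l c _.
    by rewrite /hits /= inE eqxx.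
  apply: sub_all nH => d /orP[->//|/andP[hd ->]]; rewrite andbT.
  apply/orP; right; have /hasP[l ld lH] := hd; apply/hasP; exists l => //.
  by rewrite mem_cat lH orbT.
- apply/andP; split; first by apply/allP => l lc; rewrite mem_cat map_f.
  by apply: sub_all HV => d; apply: sub_all => l lH; rewrite mem_cat lH orbT.
- by move=> d; rewrite !inE => /orP[->//|/Hsub ->]; rewrite orbT.
apply: le_trans (prob_cons_disjoint HV tc nh kc) _.
by rewrite exprS ler_wpM2l // falsify_bound_ge0.
Qed.

(** With x = 2^-k, the Bernoulli-like bound (1 - x)^m (1 + m x) <= 1 shows that any [h] above 1 /
    (eps x) is enough. *)
Lemma falsify_bound_small k (eps : rat) : (0 < eps)%R ->
  exists h, forall m, h <= m -> (falsify_bound k ^+ m < eps)%R.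
Proof.
move=> eps0; set x := ((2 ^+ k)^-1 : rat)%R.
have x0 : (0 < x)%R by rewrite invr_gt0 exprn_gt0.
have bern m : (falsify_bound k ^+ m * (1 + m%:R * x) <= 1)%R.
  elim: m => [|m IH]; first by rewrite expr0 mul0r addr0 mulr1.
  apply: le_trans IH; rewrite exprS -mulrA mulrCA ler_wpM2l ?exprn_ge0 ?falsify_bound_ge0 //.
  rewrite /falsify_bound -/x -natr1 -subr_ge0.
  have -> : (1 + m%:R * x - (1 - x) * (1 + (m%:R + 1) * x) = (m%:R + 1) * (x * x))%R by ring.
  by rewrite mulr_ge0 ?addr_ge0 ?ler0n // mulr_ge0 // ltW.
have [h Hh] : exists h : nat, ((eps * x)^-1 < h%:R)%R.
  by exists (Num.bound (eps * x)^-1); rewrite archi_boundP // invr_ge0 mulr_ge0 ?ltW.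
exists h => m lehm; rewrite ltNge; apply/negP => Heps.
have := bern m; rewrite leNgt => /negP; apply.
have lt1 : (1 < eps * (m%:R * x))%R.
  rewrite mulrCA -ltr_pdivrMr ?mulr_gt0 // div1r.
  by apply: lt_le_trans Hh _; rewrite ler_nat.
apply: lt_le_trans lt1 _; apply: le_trans (_ : eps * (1 + m%:R * x) <= _)%R.
  by rewrite ler_pM2l // lerDr.
by rewrite ler_wpM2r // addr_ge0 // mulr_ge0 // ltW.
Qed.

(** A tautological clause may be disjoint from all the others without lowering the probability,
    which would defeat the packing argument. *)
Definition nontautological n (phi : cnf n) : cnf n := [seq c <- phi | ~~ tautology c].

Lemma satisfies_nontautological n (phi : cnf n) a :
  satisfies a (nontautological phi) = satisfies a phi.
Proof.
rewrite /satisfies all_filter; apply: eq_all => c /=.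
case: (boolP (tautology c)) => //= /hasP[l lc lc']; apply/esym/hasP.
case: (boolP (a l.1 == l.2)) => [E|nE]; first by exists l.
by exists (l.1, ~~ l.2) => //=; case: (a l.1) (l.2) nE => [] [].
Qed.

Lemma prob_nontautological n (phi : cnf n) : prob (nontautological phi) = prob phi.
Proof.
rewrite /prob /num_sat; congr (_%:R / _)%R; apply: eq_card => a.
by rewrite !inE satisfies_nontautological.
Qed.

Lemma kcnf_nontautological n k (phi : cnf n) : is_kcnf k phi -> is_kcnf k (nontautological phi).
Proof. by rewrite /is_kcnf all_filter; apply: sub_all => c /= ->; rewrite implybT. Qed.

Lemma all_nontautological n (phi : cnf n) : all (predC (@tautology n)) (nontautological phi).
Proof. exact: filter_all. Qed.

Lemma small_hitting k (delta : rat) : (0 < delta)%R -> exists s, forall n (phi : cnf n),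
  is_kcnf k.+1 phi -> all (predC (@tautology n)) phi -> (delta <= prob phi)%R ->
  exists2 H, size H <= s & nearly_kcnf k H phi.
Proof.
move=> d0; have [h Hh] := falsify_bound_small k.+1 d0.
exists (k.+1 * h) => n phi kphi tphi dp.
have [H [m [szH nH Hp]]] := packing kphi tphi.
exists H => //; apply: leq_trans szH _; rewrite leq_mul2l /= leqNgt; apply/negP => lthm.
by have := lt_le_trans (Hh m (ltnW lthm)) (le_trans dp Hp); rewrite ltxx.
Qed.

(** * Approximation from below on boundedly many variables *)

Lemma cond_all_nontautological n x b (phi : cnf n) : all (predC (@tautology n)) phi ->
  all (predC (@tautology n)) (cond x b phi).
Proof.
move=> /allP H; apply/allP => c' /mapP[c]; rewrite mem_filter => /andP[_ /H /= nt] ->.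
apply: contra nt => /hasP[l]; rewrite !mem_filter => /andP[_ lc] /andP[_ lc'].
by apply/hasP; exists l.
Qed.

(** Branching on the variables of [H] leads to formulas with clauses of size at most [k]. The errors
    are averaged along the tree, so they do not accumulate; only the set of variables grows. *)
Lemma approximation_step k C (eps : rat) :
  (forall n (phi : cnf n), is_kcnf k phi -> all (predC (@tautology n)) phi ->
     exists2 V, size V <= C & (prob phi - eps <= prob (keep V phi))%R) ->
  forall s, exists C', forall n (phi : cnf n) H, size H <= s -> nearly_kcnf k H phi ->
    all (predC (@tautology n)) phi ->
    exists V, [/\ size V <= C', {subset H <= V} & (prob phi - eps <= prob (keep V phi))%R].
Proof.
move=> HC; elim=> [|s [C' IH]].
  exists C => n phi [|//] _ /nearly_kcnf_nil kphi tphi.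
  by have [V szV HV] := HC n phi kphi tphi; exists V; split.
(* One for [x] and one set for each of its values; the maximum covers an empty [H]. *)
exists (maxn C' (1 + (C' + C'))) => n phi [|x H] szH nH tphi.
  have [V [szV HV Hp]] := IH n phi [::] isT nH tphi.
  by exists V; split=> //; rewrite leq_max szV.
have [V1 [szV1 HV1 Hp1]] :=
  IH n _ H szH (nearly_kcnf_cond true nH) (cond_all_nontautological x true tphi).
have [V0 [szV0 HV0 Hp0]] :=
  IH n _ H szH (nearly_kcnf_cond false nH) (cond_all_nontautological x false tphi).
exists (x :: V1 ++ V0); split.
- by rewrite /= size_cat leq_max add1n ltnS leq_add ?orbT.
- by move=> y; rewrite !inE mem_cat => /orP[->//|/HV1 ->]; rewrite orbT.
have xV : x \in x :: V1 ++ V0 by rewrite inE eqxx.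
rewrite (prob_cond x) (prob_cond x (keep _ _)) !(cond_keep _ _ xV).
have sub1 : {subset V1 <= x :: V1 ++ V0} by move=> y yV; rewrite inE mem_cat yV orbT.
have sub0 : {subset V0 <= x :: V1 ++ V0} by move=> y yV; rewrite inE mem_cat yV !orbT.
have := le_trans Hp1 (keep_mono (cond x true phi) sub1).
have := le_trans Hp0 (keep_mono (cond x false phi) sub0).
move: (prob _) (prob _) (prob _) (prob _) => p q r s'; lra.
Qed.

(** If the probability is below [eps], the empty set is good enough; otherwise a small hitting set
    exists and the induction on [k] goes through it. *)
Lemma approximation k (eps : rat) : (0 < eps)%R -> exists C, forall n (phi : cnf n),
  is_kcnf k phi -> all (predC (@tautology n)) phi ->
  exists2 V, size V <= C & (prob phi - eps <= prob (keep V phi))%R.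
Proof.
move=> eps0; elim: k => [|k [C HC]].
  exists 0 => n phi /allP kphi _; exists [::] => //.
  have -> : keep [::] phi = phi.
    rewrite -[RHS]map_id; apply/eq_in_map => c /kphi; rewrite leqn0 => /nilP -> //.
  by rewrite lerBlDr lerDl ltW.
have [s Hs] := small_hitting k eps0.
have [C' HC'] := approximation_step HC s.
exists C' => n phi kphi tphi; case: (lerP eps (prob phi)) => Hp.
  have [H szH nH] := Hs n phi kphi tphi Hp.
  by have [V [szV _ HV]] := HC' n phi H szH nH tphi; exists V.
by exists [::] => //; apply: le_trans (prob_ge0 _); rewrite subr_le0 ltW.
Qed.

(** [V] is also made to contain the hitting set, so that fixing [V] shortens all the clauses of
    maximal size. *)
Lemma approximation_hitting k (delta eps : rat) : (0 < delta)%R -> (0 < eps)%R ->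
  exists C, forall n (phi : cnf n), is_kcnf k.+1 phi -> all (predC (@tautology n)) phi ->
  (delta <= prob phi)%R ->
  exists V H, [/\ size V <= C, {subset H <= V}, nearly_kcnf k H phi &
     (prob phi - eps <= prob (keep V phi))%R].
Proof.
move=> d0 e0; have [C HC] := approximation k e0.
have [s Hs] := small_hitting k d0.
have [C' HC'] := approximation_step HC s.
exists C' => n phi kphi tphi Hp; have [H szH nH] := Hs n phi kphi tphi Hp.
by have [V [szV HV HpV]] := HC' n phi H szH nH tphi; exists V, H; split.
Qed.

(* No infinite increasing sequence, in the form that is stable under sums. *)
Definition descending_set (S : rat -> Prop) : Prop :=
  forall f : nat -> rat, (forall i, S (f i)) ->
  exists g : nat -> nat, (forall i, g i < g i.+1) /\ (forall i, f (g i.+1) <= f (g i))%R.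

Lemma increasing_leq (g : nat -> nat) : (forall i, g i < g i.+1) ->
  forall i j, i <= j -> g i <= g j.
Proof.
move=> H i j /subnKC <-; elim: (j - i) => [|d IH]; first by rewrite addn0.
by rewrite addnS; exact: leq_trans IH (ltnW (H _)).
Qed.

Lemma increasing_ge (g : nat -> nat) : (forall i, g i < g i.+1) -> forall i, i <= g i.
Proof. by move=> H; elim=> // i IH; exact: leq_ltn_trans IH (H i). Qed.

Lemma nonincreasing_le (f : nat -> rat) : (forall i, f i.+1 <= f i)%R ->
  forall i j, i <= j -> (f j <= f i)%R.
Proof.
by move=> H i j /subnKC <-; elim: (j - i) => [|d IH]; rewrite ?addn0 // addnS (le_trans (H _)).
Qed.

Lemma increasing_lt (g : nat -> nat) : (forall i, g i < g i.+1) ->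
  forall i j, i < j -> g i < g j.
Proof. by move=> H i j ltij; apply: leq_trans (H i) (increasing_leq H ltij). Qed.

(** Extract indices along which the first terms descend, then among them indices along which the
    second terms descend too. *)
Lemma descending_average S : descending_set S ->
  descending_set (fun r => exists p q, [/\ S p, S q & r = ((p + q) / 2)%R]).
Proof.
move=> HS f Hf.
have [p Hp] := functional_choice _ Hf.
have [q Hq] := functional_choice _ Hp.
have [g1 [G1 F1]] := HS p (fun i => let: And3 H _ _ := Hq i in H).
have [g2 [G2 F2]] := HS (q \o g1) (fun i => let: And3 _ H _ := Hq (g1 i) in H).
exists (g1 \o g2); split=> i /=; first exact: increasing_lt.
have [_ _ ->] := Hq (g1 (g2 i.+1)); have [_ _ ->] := Hq (g1 (g2 i)).
have := F2 i; have := nonincreasing_le (f := p \o g1) F1 (ltnW (G2 i)) => /=.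
move: (p _) (p _) (q _) (q _) => a b c d; lra.
Qed.

Lemma descending_averages s S : descending_set S -> descending_set (averages s S).
Proof. by move=> HS; elim: s => //= s IH; exact: descending_average. Qed.

(** Dependent choice, with indices paired with their proofs of [Q] so that the successor function is
    total. *)
Lemma increasing_chain (Q : nat -> Prop) (E : nat -> nat -> Prop) i0 : Q i0 ->
  (forall i, Q i -> exists j, [/\ i < j, Q j & E i j]) ->
  exists g : nat -> nat, (forall i, g i < g i.+1) /\
    (forall i, Q (g i) /\ E (g i) (g i.+1)).
Proof.
move=> Q0 HQ.
have HQ' (i : {i | Q i}) : exists j : {j | Q j},
    proj1_sig i < proj1_sig j /\ E (proj1_sig i) (proj1_sig j).
  by case: i => i Qi; have [j [ltij Qj Eij]] := HQ i Qi; exists (exist _ j Qj).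
have [nx Hnx] := functional_choice _ HQ'.
exists (fun i => proj1_sig (iter i nx (exist _ i0 Q0))).
split=> i; first by have [] := Hnx (iter i nx (exist _ i0 Q0)).
by split; [exact: proj2_sig | have [] := Hnx (iter i nx (exist _ i0 Q0))].
Qed.

Lemma infinitely_often (Q : nat -> Prop) : (forall m, exists2 i, m <= i & Q i) ->
  exists g : nat -> nat, (forall i, g i < g i.+1) /\ (forall i, Q (g i)).
Proof.
move=> H; have [i0 _ Q0] := H 0.
have [i Qi|g [G1 G2]] := @increasing_chain Q (fun _ _ => True) i0 Q0.
  by have [j ltj Qj] := H i.+1; exists j.
by exists g; split=> // i; have [] := G2 i.
Qed.

(* The spectrum is cut at some [delta]: above it, a formula is a bounded average of
   formulas with smaller clauses; a sequence that does not stay above any [delta] tends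
   to 0. *)
Lemma descending_spectrum k : descending_set (spectrum k).
Proof.
elim: k => [|k IH] f Hf.
  (* With clauses of size 0, a formula is empty, hence true, or contains the empty clause. *)
  have f01 i : f i = 0%R \/ f i = 1%R.
    have [n [phi [kphi ->]]] := Hf i.
    rewrite /prob /num_sat; case: phi kphi => [|c phi] /=.
      move=> _; right; rewrite (_ : [set a | _] = setT); last by apply/setP => a; rewrite !inE.
      by rewrite cardsT card_ffun card_bool card_ord natrX divff // expf_neq0.
    rewrite leqn0 => /andP[/nilP -> _]; left.
    by rewrite (_ : [set a | _] = set0) ?cards0 ?mul0r //; apply/setP => a; rewrite !inE.
  case: (classic (forall m, exists2 i, m <= i & f i = 0%R)) => [/infinitely_often[g [G1 G2]]|H0].
    by exists g; split=> // i; rewrite !G2.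
  have [m Hm] : exists m, forall i, m <= i -> f i = 1%R.
    apply: NNPP => Hn; apply: H0 => m; apply: NNPP => Hn2; apply: Hn; exists m => i lemi.
    by case: (f01 i) => // E0; case: Hn2; exists i.
  by exists (addn m); split=> i; rewrite ?addnS // !Hm ?leqW ?leq_addr.
case: (classic (exists2 d : rat, (0 < d)%R & forall m, exists2 i, m <= i & (d <= f i)%R)).
  move=> [d d0 /infinitely_often[g [G1 G2]]].
  have [s Hs] := small_hitting k d0.
  have [|g' [G1' G2']] := @descending_averages s _ IH (f \o g).
    move=> i /=; have := G2 i; have [n [phi [kphi ->]]] := Hf (g i).
    rewrite -prob_nontautological => Hd.
    have [H szH nH] := Hs n _ (kcnf_nontautological kphi) (all_nontautological phi) Hd.
    exact: averagesW szH (prob_averages nH).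
  by exists (g \o g'); split=> // i /=; exact: increasing_lt.
move=> Hsmall.
have {}Hsmall d : (0 < d)%R -> exists m, forall i, m <= i -> (f i < d)%R.
  move=> d0; apply: NNPP => Hn; apply: Hsmall; exists d => // m.
  apply: NNPP => Hn2; apply: Hn; exists m => i lemi; rewrite ltNge; apply/negP => Hd.
  by apply: Hn2; exists i.
case: (classic (forall m, exists2 i, m <= i & f i = 0%R)) => [/infinitely_often[g [G1 G2]]|H0].
  by exists g; split=> // i; rewrite !G2.
have [m Hm] : exists m, forall i, m <= i -> (0 < f i)%R.
  apply: NNPP => Hn; apply: H0 => m; apply: NNPP => Hn2; apply: Hn; exists m => i lemi.
  have [n [phi [_ Ef]]] := Hf i; rewrite lt0r Ef prob_ge0 andbT -Ef; apply/eqP => E0.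
  by apply: Hn2; exists i.
(* The terms are positive and tend to 0, so each one eventually dominates all later ones. *)
have [i Hi|g [G1 G2]] :=
    @increasing_chain (fun i => m <= i) (fun i j => (f j <= f i)%R) m (leqnn m).
  have [m' Hm'] := Hsmall _ (Hm i Hi).
  exists (maxn i.+1 m'); split; rewrite ?leq_max ?leqnn ?(leqW Hi) //.
  by apply/ltW/Hm'; rewrite leq_max leqnn orbT.
by exists g; split=> // i; have [] := G2 i.
Qed.

(** Without a gap, some values of the spectrum below [rho] would tend to [rho]; a descending
    subsequence of them stays below its first term, hence away from [rho]. *)
Lemma spectrum_gap k (rho : rat) : exists2 eps : rat, (0 < eps)%R &
  forall r, spectrum k r -> (r < rho)%R -> (r <= rho - eps)%R.
Proof.
apply: NNPP => Hn.
have H i : exists r, [/\ spectrum k r, (r < rho)%R & (rho - i.+1%:R^-1 < r)%R].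
  apply: NNPP => Hn2; apply: Hn; exists (i.+1%:R^-1)%R; first by rewrite invr_gt0.
  move=> r Sr ltr; rewrite leNgt; apply/negP => lt2; apply: Hn2; by exists r.
have [f Hf] := functional_choice _ H.
have [g [G1 G2]] := descending_spectrum (fun i => let: And3 H _ _ := Hf i in H).
have [_ lt0 _] := Hf (g 0).
have d0 : (0 < rho - f (g 0))%R by rewrite subr_gt0.
set b := Num.bound (rho - f (g 0))^-1.
have Hb : ((rho - f (g 0))^-1 < b%:R)%R by rewrite archi_boundP // invr_ge0 ltW.
have [_ _ Hgb] := Hf (g b).
have le0 := nonincreasing_le (f := f \o g) G2 (leq0n b).
have := lt_le_trans Hgb le0; rewrite /= ltNge => /negP; apply.
rewrite lerBrDr -lerBrDl -[X in (_ <= X)%R]invrK lef_pV2 ?posrE ?invr_gt0 //.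
by apply: le_trans (ltW Hb) _; rewrite ler_nat (leq_trans (increasing_ge G1 b)).
Qed.

(** * Satisfiability of 2-CNF formulas *)

Definition same_literal (T : Type) (K : eqType) (var : T -> K) (sg : T -> bool) : rel T :=
  fun z w => (var z == var w) && (sg z == sg w).

Definition opposite (T : Type) (K : eqType) (var : T -> K) (sg : T -> bool) : rel T :=
  fun z w => (var z == var w) && (sg z != sg w).

(* Edges between the occurrences of literals of a 2-CNF: if [z] is false, so is [w]. *)
Definition implies_false (T : finType) (K : eqType) (var : T -> K) (sg : T -> bool)
    (R : rel T) : rel T :=
  fun z w => same_literal var sg z w || [exists y, R z y && opposite var sg y w].

Lemma opposite_sym (T : Type) (K : eqType) (var : T -> K) sg :
  symmetric (@opposite T K var sg).
Proof. by move=> z w; rewrite /opposite eq_sym (eq_sym (sg z)). Qed.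

Lemma opposite2 (T : Type) (K : eqType) (var : T -> K) sg u z w :
  @opposite T K var sg z u -> opposite var sg z w -> same_literal var sg u w.
Proof.
rewrite /opposite /same_literal => /andP[/eqP <- nu] /andP[/eqP <- nw]; rewrite eqxx /=.
by case: (sg z) (sg u) (sg w) nu nw => [] [] [].
Qed.

(** Skew symmetry of the implication graph: the path is reversed edge by edge, using the symmetry of
    [R]. *)
Lemma implies_false_contra (T : finType) (K : eqType) (var : T -> K) (sg : T -> bool)
    (R : rel T) z u w v :
  symmetric R -> connect (implies_false var sg R) z u ->
  opposite var sg z w -> opposite var sg u v -> connect (implies_false var sg R) v w.
Proof.
move=> symR /connectP[p]; elim: p z w => [|z1 p IH] z w /=.
  move=> _ -> ozw ouv; apply: connect1; rewrite /implies_false.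
  by rewrite (opposite2 ouv ozw).
move=> /andP[/orP[szz1|/existsP[y /andP[Rzy oyz1]]] Hp] Eu ozw ouv.
  apply: IH Hp Eu _ ouv; move: szz1 ozw; rewrite /same_literal /opposite.
  by move=> /andP[/eqP -> /eqP ->].
apply: connect_trans (IH z1 y Hp Eu _ ouv) _; first by rewrite opposite_sym.
apply: connect1; rewrite /implies_false; apply/orP; right; apply/existsP; exists z.
by rewrite symR Rzy.
Qed.

(** The vertices are occurrences, so a literal can have several vertices and its negation none;
    [opposite] is therefore a relation and not an involution. *)
Lemma two_sat (T : finType) (K : eqType) (var : T -> K) (sg : T -> bool) (R : rel T) :
  symmetric R ->
  (forall z w, opposite var sg z w -> connect (implies_false var sg R) z w ->
     ~~ connect (implies_false var sg R) w z) ->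
  exists a : K -> bool, forall z y, R z y -> (a (var z) == sg z) || (a (var y) == sg y).
Proof.
move=> symR Hcyc; set E := implies_false var sg R in Hcyc.
(* The third condition matters at the end: the conflict between two falsified occurrences of one
   clause [R z y] is visible only through an occurrence opposite to [y]. *)
pose good (F : {set T}) := [/\ forall z w, z \in F -> E z w -> w \in F,
  forall z w, z \in F -> w \in F -> ~~ opposite var sg z w &
  forall z, z \in F -> exists w, opposite var sg z w].
(* [F] is a maximal consistent set of falsified occurrences, closed under implication. *)
have [F [[clF conF oppF] maxF]] : exists F, good F /\
    forall z w, opposite var sg z w -> (z \in F) || (w \in F).
  have g0 : good set0 by split=> z; rewrite ?inE // => w; rewrite inE.
  have [m] := ubnP #|~: (set0 : {set T})|; move: set0 g0.
  elim: m => // m IH F gF; rewrite ltnS => lem.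
  case: (boolP [exists z, [exists w,
      [&& opposite var sg z w, z \notin F & w \notin F]]]); last first.
    move=> /existsPn H; exists F; split=> // z w ozw.
    have /existsPn/(_ w) := H z.
    by rewrite ozw /= negb_and !negbK.
  move=> /existsP[z /existsP[w /and3P[ozw nzF nwF]]].
  (* As [z] and [w] are on no common cycle, one of them does not reach the other, and it can be
     falsified with all that it reaches. *)
  wlog : z w ozw nzF nwF / ~~ connect E z w => [Hw|ncon].
    case: (boolP (connect E z w)) => [czw|]; last exact: Hw ozw nzF nwF.
    by apply: (Hw w z) => //; [rewrite opposite_sym | exact: Hcyc].
  have [clF conF oppF] := gF.
  have undec u : opposite var sg z u -> u \notin F.
    move=> ozu; apply: contra nwF => uF; apply: clF uF _.
    by rewrite /E /implies_false (opposite2 (z := z)) // opposite_sym.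
  pose F' := F :|: [set u | connect E z u].
  have oppE u v : E u v -> (exists w, opposite var sg u w) -> exists w, opposite var sg v w.
    move=> /orP[suv|/existsP[y /andP[_ oy]]] [w' ou]; last by exists y; rewrite opposite_sym.
    by exists w'; move: suv ou; rewrite /same_literal /opposite => /andP[/eqP -> /eqP ->].
  have oppz u : connect E z u -> exists v, opposite var sg u v.
    move=> /connectP[p Hp ->]; elim: p (z) Hp (ex_intro _ w ozw : exists w, opposite var sg z w)
      => [|z1 p IHp] z0 //= /andP[/oppE Ez Hp] oz; exact: IHp Hp (Ez oz).
  have zu u v : connect E z u -> opposite var sg u v -> connect E v w.
    by move=> czu ouv; exact: implies_false_contra symR czu ozw ouv.
  have clF' u v : u \in F' -> E u v -> v \in F'.
    rewrite !inE => /orP[uF|czu] Euv; first by rewrite (clF _ _ uF Euv).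
    by rewrite (connect_trans czu (connect1 Euv)) orbT.
  have clFc u v : u \in F -> connect E u v -> v \in F.
    move=> uF /connectP[p]; elim: p u uF => [|x p IHp] u uF /=; first by move=> _ ->.
    by move=> /andP[Eux Hp] Ev; apply: IHp Hp Ev; exact: clF Eux.
  apply: (IH F').
    split=> //; last by move=> u; rewrite !inE => /orP[/oppF|/oppz].
    move=> u v; rewrite !inE => /orP[uF|czu] /orP[vF|czv].
    - exact: conF.
    - apply/negP; rewrite opposite_sym => ovu; case/negP: nwF.
      exact: clFc uF (zu _ _ czv ovu).
    - apply/negP => ouv; case/negP: nwF; exact: clFc vF (zu _ _ czu ouv).
    - apply/negP => ouv; case/negP: ncon.
      exact: connect_trans czv (zu _ _ czu ouv).
  apply: leq_trans lem; apply: proper_card; rewrite properE setCS subsetUl /=.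
  apply/subsetPn; exists z; first by rewrite inE.
  by rewrite !inE connect0 orbT.
(* A variable with a falsified occurrence takes the opposite of its sign; by [maxF], any other
   variable occurs with one sign only and takes it. *)
pose a (k : K) := if [pick z in F | var z == k] is Some z then ~~ sg z
                  else if [pick z | var z == k] is Some z then sg z else true.
have aF z : a (var z) != sg z -> z \in F.
  rewrite /a; case: pickP => [z' /andP[z'F /eqP Ev] ns|H].
    apply: clF z'F _; apply/orP; left.
    by rewrite /same_literal Ev eqxx; case: (sg z') (sg z) ns => [] [].
  case: pickP => [z' /eqP Ev ns|/(_ z)]; last by rewrite eqxx.
  have : opposite var sg z z' by rewrite /opposite Ev eqxx eq_sym.
  by move=> /maxF /orP[zF|zF]; have := H z; have := H z'; rewrite ?zF ?Ev ?eqxx.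
exists a => z y Rzy; apply/norP => -[/aF zF /aF yF].
have [w oyw] := oppF y yF.
have wF : w \in F by apply: clF zF _; apply/orP; right; apply/existsP; exists y; rewrite Rzy.
by have := conF _ _ yF wF; rewrite oyw.
Qed.

Lemma two_sat_sound (T : finType) (K : eqType) (var : T -> K) (sg : T -> bool) (R : rel T)
    (a : K -> bool) :
  (forall z y, R z y -> (a (var z) == sg z) || (a (var y) == sg y)) ->
  forall z w, opposite var sg z w -> connect (implies_false var sg R) z w ->
    ~~ connect (implies_false var sg R) w z.
Proof.
move=> HR.
have H z w : connect (implies_false var sg R) z w -> a (var z) != sg z -> a (var w) != sg w.
  move=> /connectP[p Hp ->]; elim: p z Hp => //= y p IH z /andP[Ezy Hp] nz; apply: IH => //.
  case/orP: Ezy => [/andP[/eqP <- /eqP <-] //|/existsP[u /andP[Rzu /andP[/eqP <- nuy]]]].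
  by have := HR _ _ Rzu; rewrite (negbTE nz) => /eqP ->.
move=> z w /andP[/eqP Ev ns] czw; apply/negP => cwz.
case: (boolP (a (var z) == sg z)) => [az|naz].
  have naw : a (var w) != sg w by rewrite -Ev (eqP az).
  by have := H _ _ cwz naw; rewrite az.
have := H _ _ czw naz; rewrite -Ev.
by move: naz ns; case: (a _) (sg z) (sg w) => [] [] [].
Qed.

(** * Partial assignments *)

(* The partial assignment giving the [i]-th value to the [i]-th key; the first
   occurrence of a repeated key prevails. *)
Fixpoint value (vs : seq (seq bool)) (alpha : seq bool) (u : seq bool) : option bool :=
  match vs, alpha with
  | v :: vs', b :: alpha' => if v == u then Some b else value vs' alpha' u
  | _, _ => None
  end.

Definition mix n (vs : seq (seq bool)) (alpha : seq bool) (a : {ffun 'I_n -> bool}) :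
    {ffun 'I_n -> bool} :=
  [ffun x : 'I_n => odflt (a x) (value vs alpha (bits x))].

Fixpoint bool_words (m : nat) : seq (seq bool) :=
  if m is m'.+1 then map (cons true) (bool_words m') ++ map (cons false) (bool_words m')
  else [:: [::]].

Lemma mem_bool_words m u : (u \in bool_words m) = (size u == m).
Proof.
elim: m u => [|m IH] u; first by rewrite inE; case: u.
rewrite mem_cat; apply/orP/eqP => [[] /mapP[v]|].
- by rewrite IH => /eqP <- ->.
- by rewrite IH => /eqP <- ->.
case: u => // -[] u [Es]; [left|right]; apply: map_f; by rewrite IH Es.
Qed.

(** For uniform [alpha] and [a], the mixed assignment is uniform even when keys repeat or belong to
    no variable. Hence nothing has to be checked about the pointers. *)
Lemma sum_mix n (vs : seq (seq bool)) (F : {ffun 'I_n -> bool} -> nat) :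
  \sum_(alpha <- bool_words (size vs)) \sum_a F (mix vs alpha a) = 2 ^ size vs * \sum_a F a.
Proof.
elim: vs F => [|v vs IH] F /=.
  rewrite big_seq1 mul1n; apply: eq_bigr => a _; congr F.
  by apply/ffunP=> x; rewrite ffunE.
rewrite big_cat !big_map /=.
case: (pickP (fun x : 'I_n => bits x == v)) => [x /eqP Ex|nx].
  have E b alpha a : mix (v :: vs) (b :: alpha) a = assign (mix vs alpha a) x b.
    apply/ffunP=> y; rewrite !ffunE /= -Ex.
    rewrite (_ : (bits x == bits y) = (y == x)); first by case: (y == x).
    apply/eqP/eqP => [/bits_inj E|-> //]; exact: val_inj.
  under eq_bigr do under eq_bigr do rewrite E.
  under [X in _ + X]eq_bigr do under eq_bigr do rewrite E.
  rewrite (IH (fun a => F (assign a x true))) (IH (fun a => F (assign a x false))).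
  rewrite -mulnDr !sum_assign -mulnDr mulnA expnSr; congr (_ * _).
  rewrite [RHS](bigID (fun a : {ffun 'I_n -> bool} => a x == true)) /=; congr (_ + _).
  by apply: eq_bigl => a; case: (a x).
have E b alpha a : mix (v :: vs) (b :: alpha) a = mix vs alpha a :> {ffun 'I_n -> bool}.
  by apply/ffunP=> y; rewrite !ffunE /= eq_sym (nx y).
under eq_bigr do under eq_bigr do rewrite E.
under [X in _ + X]eq_bigr do under eq_bigr do rewrite E.
by rewrite IH addnn -mul2n mulnA expnS.
Qed.

Definition active n vs alpha (c : clause n) : bool :=
  ~~ tautology c && ~~ has (fun l : literal n => value vs alpha (bits l.1) == Some l.2) c.

Definition designated n (vs : seq (seq bool)) : seq 'I_n :=
  [seq x : 'I_n <- enum 'I_n | bits x \in vs].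

Lemma value_some vs alpha u : size alpha = size vs ->
  (u \in vs) = (value vs alpha u != None).
Proof.
elim: vs alpha => [|v vs IH] [|b alpha] //= [/IH {}IH].
by rewrite inE IH eq_sym; case: eqP.
Qed.

Lemma satisfies_mix_keep n vs alpha a (phi : cnf n) : size alpha = size vs ->
  satisfies (mix vs alpha a) (keep (designated n vs) (nontautological phi)) =
  ~~ has (active vs alpha) phi.
Proof.
move=> Es; rewrite -all_predC /satisfies /keep all_map /nontautological all_filter.
apply: eq_all => c /=; rewrite /active implybE negb_and !negbK; congr (_ || _).
elim: c => //= l c IH; rewrite /designated mem_filter mem_enum andbT (value_some _ Es).
case Ev: (value vs alpha (bits l.1)) => [b|] //=.
by rewrite IH ffunE Ev.
Qed.

(** The probability of the kept formula becomes a count over the [2 ^ size vs] partial assignments,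
    a constant number of cases for the query. *)
Lemma count_inactive n vs (phi : cnf n) :
  count (fun alpha => ~~ has (active vs alpha) phi) (bool_words (size vs)) * 2 ^ n =
  2 ^ size vs * num_sat (keep (designated n vs) (nontautological phi)).
Proof.
rewrite num_satE -(sum_mix vs (fun a => satisfies a _ : nat)) -sum1_count big_distrl /=.
rewrite big_mkcond /= [LHS]big_seq [RHS]big_seq; apply: eq_bigr => alpha.
rewrite mem_bool_words => /eqP Es.
under [RHS]eq_bigr do rewrite satisfies_mix_keep //.
rewrite sum_nat_const card_ffun card_bool card_ord.
by case: (has _ _); rewrite ?mul0n ?muln0 ?mul1n ?muln1.
Qed.

(** * Acceptance of a tuple of pointers *)

Definition clause_at (s : seq symbol) (k : nat) : seq raw_literal :=
  map (literal_at s) (literals_of_clause s (rank is_clause s k)).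

Definition raw_active vs alpha (c : seq raw_literal) : bool :=
  ~~ has (fun l : raw_literal => (~~ l.1, l.2) \in c) c &&
  ~~ has (fun l : raw_literal => value vs alpha l.2 == Some l.1) c.

Definition active_at s vs alpha k : bool :=
  is_clause (letter_at s k) && raw_active vs alpha (clause_at s k).

Definition free_at s vs alpha k z : bool :=
  (z \in literals_of_clause s (rank is_clause s k)) && (value vs alpha (key s z) == None).

(* A clause with a single free literal is covered by [z = y]. *)
Definition residual s vs alpha k z y : bool :=
  [&& free_at s vs alpha k z, free_at s vs alpha k y &
      all (fun u => free_at s vs alpha k u ==> (u == z) || (u == y)) (iota 0 (size s))].

Definition constrained s vs alpha z y : bool :=
  has (fun k => active_at s vs alpha k && residual s vs alpha k z y) (iota 0 (size s)).

Definition sign_at s z := literal_sign (letter_at s z).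

Definition falsity_edge s vs alpha z w : bool :=
  same_literal (key s) (sign_at s) z w ||
  has (fun y => constrained s vs alpha z y && opposite (key s) (sign_at s) y w)
    (iota 0 (size s)).

(** The first part rejects an active clause left with no free literal or with more than two; the
    second is the cycle criterion for the remaining 2-CNF. *)
Definition extendable s vs alpha : bool :=
  all (fun k => active_at s vs alpha k ==>
     has (fun z => has (fun y => residual s vs alpha k z y) (iota 0 (size s))) (iota 0 (size s)))
    (iota 0 (size s)) &&
  ~~ has (fun z => has (fun w => [&& opposite (key s) (sign_at s) z w,
       reachable (size s) (falsity_edge s vs alpha) z w &
       reachable (size s) (falsity_edge s vs alpha) w z]) (iota 0 (size s))) (iota 0 (size s)).

Lemma raw_literal_of_inj n : injective (@raw_literal_of n).
Proof. by move=> [x b] [y c] [-> /bits_inj E]; congr pair; exact: val_inj. Qed.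

Lemma raw_activeE n vs alpha (c : clause n) :
  raw_active vs alpha (map (@raw_literal_of n) c) = active vs alpha c.
Proof.
rewrite /raw_active /active !has_map; congr (~~ _ && ~~ _).
apply: eq_has => l /=; rewrite -[(~~ _, _)]/(raw_literal_of (l.1, ~~ l.2)).
by rewrite mem_map //; exact: raw_literal_of_inj.
Qed.

Lemma mem_iotaP n i : (i \in iota 0 n) = (i < n).
Proof. by rewrite mem_iota. Qed.

Lemma reachable_connect n (r : rel nat) (i j : 'I_n) (r' : rel 'I_n) :
  (forall x y : 'I_n, r x y = r' x y) -> reachable n r i j = connect r' i j.
Proof.
move=> Er; rewrite /reachable; apply/existsP/idP => [[i' /existsP[j' /and3P[/eqP Ei /eqP Ej]]]|Hc].
  by rewrite (val_inj Ei) (val_inj Ej) (eq_connect (e' := r')).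
exists i; apply/existsP; exists j; rewrite !eqxx /=.
by rewrite (eq_connect (e' := r')).
Qed.

Section Encoded.

Variables (n : nat) (phi : cnf n).
Let s := encode_cnf phi.
Let N := size s.

Lemma clauses_encoded :
  map (map (@raw_literal_of n)) phi = map (clause_at s) (clause_positions s).
Proof. by have [_ _ ->] := raw_of_positions (raw_of_cnf phi). Qed.

Lemma clause_positionP c : c \in phi ->
  exists2 k, k \in clause_positions s & map (@raw_literal_of n) c = clause_at s k.
Proof. by move=> /(map_f (map (@raw_literal_of n))); rewrite clauses_encoded => /mapP. Qed.

Lemma clause_atP k : k \in clause_positions s ->
  exists2 c, c \in phi & clause_at s k = map (@raw_literal_of n) c.
Proof. by move=> /(map_f (clause_at s)); rewrite -clauses_encoded => /mapP. Qed.

Lemma mem_clause_positions k :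
  (k \in clause_positions s) = (k < N) && is_clause (letter_at s k).
Proof. by rewrite mem_filter mem_iota andbC. Qed.

Variables (vs : seq (seq bool)) (alpha : seq bool).

Lemma active_atP k : k < N -> active_at s vs alpha k ->
  exists c, [/\ c \in phi, active vs alpha c & clause_at s k = map (@raw_literal_of n) c].
Proof.
move=> ltk /andP[ck ak]; have [|c cphi Ec] := clause_atP (k := k).
  by rewrite mem_clause_positions ltk.
by exists c; split=> //; rewrite -raw_activeE -Ec.
Qed.

Lemma active_position c : c \in phi -> active vs alpha c ->
  exists k, [/\ k < N, active_at s vs alpha k & clause_at s k = map (@raw_literal_of n) c].
Proof.
move=> /clause_positionP[k]; rewrite mem_clause_positions => /andP[ltk ck] Ec ac.
by exists k; split=> //; rewrite /active_at ck -Ec raw_activeE.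
Qed.

Lemma has_active : has (active_at s vs alpha) (iota 0 N) = has (active vs alpha) phi.
Proof.
apply/has_iota/hasP => [[k ltk /(active_atP ltk)[c [cphi ac _]]]|]; first by exists c.
by move=> [c cphi /(active_position cphi)[k [ltk ak _]]]; exists k.
Qed.

Lemma free_lt k z : free_at s vs alpha k z -> z < N.
Proof. by rewrite /free_at mem_filter mem_iota => /andP[/andP[_]]. Qed.

Lemma free_literal k z c : clause_at s k = map (@raw_literal_of n) c ->
  free_at s vs alpha k z ->
  exists l : literal n, [/\ l \in c, bits l.1 = key s z, l.2 = sign_at s z &
    value vs alpha (bits l.1) = None].
Proof.
move=> Ec /andP[zk /eqP Hv].
have := map_f (literal_at s) zk; rewrite -/(clause_at s k) Ec => /mapP[l lc [E1 E2]].
by exists l; split=> //; rewrite -E2.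
Qed.

Lemma constrained_sym (z y : nat) : constrained s vs alpha z y = constrained s vs alpha y z.
Proof.
apply: eq_has => k /=; congr (_ && _); rewrite /residual andbCA; congr [&& _, _ & _].
by apply: eq_all => u; rewrite orbC.
Qed.

Lemma falsity_edgeE (z w : 'I_N) : falsity_edge s vs alpha z w =
  implies_false (key s \o val) (sign_at s \o val)
    (fun x y : 'I_N => constrained s vs alpha x y) z w.
Proof.
rewrite /falsity_edge /implies_false; congr (_ || _).
apply/has_iota/existsP => [[y lty Hy]|[y Hy]]; first by exists (Ordinal lty).
by exists y.
Qed.

Lemma extendable_sound : extendable s vs alpha ->
  exists a : {ffun 'I_n -> bool}, satisfies (mix vs alpha a) phi.
Proof.
move=> /andP[/allP Hres Hcyc].
pose R := fun x y : 'I_N => constrained s vs alpha x y.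
have [||a Ha] := @two_sat 'I_N _ (key s \o val) (sign_at s \o val) R.
- by move=> x y; exact: constrained_sym.
- move=> z w ozw czw; apply/negP => cwz; case/negP: Hcyc.
  apply/has_iota; exists z => //; apply/has_iota; exists w => //; apply/and3P; split=> //.
  + by rewrite (reachable_connect _ _ falsity_edgeE).
  + by rewrite (reachable_connect _ _ falsity_edgeE).
exists [ffun x : 'I_n => a (bits x)]; rewrite -satisfies_nontautological.
apply/allP => c; rewrite mem_filter => /andP[nt cphi].
case: (boolP (active vs alpha c)) => [ac|]; last first.
  rewrite /active nt negbK => /hasP[l lc /eqP Hl]; apply/hasP; exists l => //.
  by rewrite !ffunE Hl.
have [k [ltk ak Ec]] := active_position cphi ac.
have := Hres k; rewrite mem_iotaP ltk ak => /(_ isT) /has_iota[z ltz /has_iota[y lty Hzy]].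
have Rzy : R (Ordinal ltz) (Ordinal lty) by apply/has_iota; exists k; rewrite // ak.
have /and3P[fz fy _] := Hzy.
have sat x : free_at s vs alpha k x -> a (key s x) == sign_at s x ->
    has (fun l : literal n => mix vs alpha [ffun x : 'I_n => a (bits x)] l.1 == l.2) c.
  move=> fx ax; have [l [lc E1 E2 E3]] := free_literal Ec fx.
  by apply/hasP; exists l => //; rewrite !ffunE E3 /= E1 E2.
by have /orP[az|ay] := Ha _ _ Rzy; [exact: sat fz az | exact: sat fy ay].
Qed.

Lemma extendable_complete (a : {ffun 'I_n -> bool}) :
  satisfies a phi -> is_kcnf 3 phi ->
  (forall (x : 'I_n) b, value vs alpha (bits x) = Some b -> a x = b) ->
  (forall c, c \in phi -> active vs alpha c ->
     (size c <= 2) || has (fun l : literal n => value vs alpha (bits l.1) != None) c) ->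
  extendable s vs alpha.
Proof.
move=> /allP sa /allP k3 Ha Has.
have sat k : k < N -> active_at s vs alpha k -> exists z (x : 'I_n),
   [/\ free_at s vs alpha k z, bits x = key s z & a x = sign_at s z].
  move=> ltk /(active_atP ltk)[c [cphi /andP[_ nc] Ec]].
  have /hasP[l lc /eqP al] := sa c cphi.
  have := map_f (@raw_literal_of n) lc; rewrite -Ec => /mapP[z zk [E1 E2]].
  exists z, l.1; split=> //; last by rewrite al.
  rewrite /free_at zk -E2 /=; case Ev: (value _ _ _) => [b|//].
  by case/hasP: nc; exists l => //; rewrite Ev -al (Ha _ _ Ev).
apply/andP; split.
  apply/allP => k; rewrite mem_iotaP => ltk; apply/implyP => ak.
  have [c [cphi ac Ec]] := active_atP ltk ak.
  set L := literals_of_clause s (rank is_clause s k).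
  pose F := [seq z <- L | value vs alpha (key s z) == None].
  have memF z : (z \in F) = free_at s vs alpha k z by rewrite mem_filter andbC.
  have szL : size L = size c by have := congr1 size Ec; rewrite !size_map.
  have leF : size F <= 2.
    case/orP: (Has c cphi ac) => [le2|/hasP[l lc Hl]].
      by rewrite (leq_trans _ le2) // -szL size_filter count_size.
    rewrite -ltnS; apply: leq_trans (k3 c cphi); rewrite -szL.
    rewrite size_filter -(count_predC (fun z => value vs alpha (key s z) == None) L).
    rewrite -[X in X < _]addn0 ltn_add2l -has_count.
    have := map_f (@raw_literal_of n) lc; rewrite -Ec => /mapP[z zk [E1 E2]].
    by apply/hasP; exists z => //; rewrite /= -E2.
  have [z0 [_ [fz0 _ _]]] := sat k ltk ak.
  move: leF; rewrite -memF in fz0; clearbody F.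
  case: F memF fz0 => [//|z [|y [|//]]] memF _ _.
    have fz : free_at s vs alpha k z by rewrite -memF inE eqxx.
    apply/has_iota; exists z; first exact: free_lt fz.
    apply/has_iota; exists z; first exact: free_lt fz.
    rewrite /residual fz; apply/allP => u _; apply/implyP.
    by rewrite -memF inE orbb.
  have fz : free_at s vs alpha k z by rewrite -memF inE eqxx.
  have fy : free_at s vs alpha k y by rewrite -memF !inE eqxx orbT.
  apply/has_iota; exists z; first exact: free_lt fz.
  apply/has_iota; exists y; first exact: free_lt fy.
  rewrite /residual fz fy; apply/allP => u _; apply/implyP.
  by rewrite -memF !inE.
(* [two_sat_sound] needs a valuation of all keys; those of no variable get false. *)
pose a' (u : seq bool) := [exists x : 'I_n, (bits x == u) && a x].
have a'E (x : 'I_n) : a' (bits x) = a x.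
  apply/existsP/idP => [[y /andP[/eqP /bits_inj /val_inj -> //]]|ax].
  by exists x; rewrite eqxx.
pose R := fun x y : 'I_N => constrained s vs alpha x y.
have HR (z y : 'I_N) : R z y -> (a' (key s z) == sign_at s z) || (a' (key s y) == sign_at s y).
  move=> /has_iota[k ltk /andP[ak /and3P[fz fy /allP Hu]]].
  have [u [x [fu E1 E2]]] := sat k ltk ak.
  have := Hu u; rewrite mem_iotaP (free_lt fu) fu => /(_ isT) /orP[] /eqP <-.
    by rewrite -E1 a'E E2 eqxx.
  by rewrite -E1 a'E E2 eqxx orbT.
apply/negP => /has_iota[z ltz /has_iota[w ltw /and3P[ozw]]].
have := two_sat_sound HR (z := Ordinal ltz) (w := Ordinal ltw) ozw.
rewrite -!(reachable_connect _ _ falsity_edgeE) /=.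
by move=> H /H /negP.
Qed.

Lemma occurrence (c : clause n) l : c \in phi -> l \in c ->
  exists2 z, z < N & key s z = bits l.1.
Proof.
move=> /clause_positionP[k _ Ec] lc.
have := map_f (@raw_literal_of n) lc; rewrite Ec => /mapP[z zk [_ ->]].
by exists z => //; move: zk; rewrite mem_filter mem_iota => /andP[_].
Qed.

End Encoded.

Definition accepts (rho : rat) s vs : bool :=
  let k := count (fun alpha => ~~ has (active_at s vs alpha) (iota 0 (size s)))
             (bool_words (size vs)) in
  (rho * 2 ^+ size vs <= k%:R)%R && ((rho * 2 ^+ size vs < k%:R)%R ||
    has (fun alpha => has (active_at s vs alpha) (iota 0 (size s)) && extendable s vs alpha)
        (bool_words (size vs))).

Lemma prob_keep_designated n (phi : cnf n) vs :
  let s := encode_cnf phi in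
  ((count (fun alpha => ~~ has (active_at s vs alpha) (iota 0 (size s)))
             (bool_words (size vs)))%:R =
   2 ^+ size vs * prob (keep (designated n vs) (nontautological phi)) :> rat)%R.
Proof.
move=> s; have := count_inactive vs phi.
rewrite (eq_count (a2 := fun alpha => ~~ has (active_at s vs alpha) (iota 0 (size s)))); last first.
  by move=> alpha; rewrite has_active.
move=> H; rewrite /prob mulrA -natrX -natrM -H natrM natrX mulfK //.
by rewrite expf_neq0.
Qed.

(** Nothing is assumed of [vs]. In the case of equality, the extension satisfies [phi] but not the
    kept formula, which makes the inequality strict. *)
Lemma accepts_sound rho n (phi : cnf n) vs :
  accepts rho (encode_cnf phi) vs -> (rho < prob phi)%R.
Proof.
rewrite /accepts prob_keep_designated mulrC; set p := prob (keep _ _).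
have C0 : (0 < 2 ^+ size vs :> rat)%R by rewrite exprn_gt0.
rewrite ler_pM2l // ltr_pM2l // => /andP[le_rho].
have sub a : satisfies a (keep (designated n vs) (nontautological phi)) -> satisfies a phi.
  by move=> /satisfies_keep; rewrite satisfies_nontautological.
case/orP => [lt_rho|/hasP[alpha]]; first exact: lt_le_trans lt_rho (prob_mono sub).
rewrite mem_bool_words => /eqP Es /andP[]; rewrite has_active => Hact /extendable_sound[a Ha].
apply: le_lt_trans le_rho (prob_lt sub Ha _).
by rewrite satisfies_mix_keep // negbK.
Qed.

(** The keys need only cover the variables of [V] that occur in [phi]: the others have no position
    to point to and do not affect the kept formula. *)
Lemma accepts_complete (rho : rat) : (0 < rho)%R ->
  exists C, forall n (phi : cnf n), is_kcnf 3 phi -> (rho < prob phi)%R ->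
  exists2 V : seq 'I_n, size V <= C & forall vs,
    (forall c l, c \in phi -> l \in c -> l.1 \in V -> bits l.1 \in vs) ->
    accepts rho (encode_cnf phi) vs.
Proof.
move=> rho0; have [eps eps0 Hgap] := spectrum_gap 3 rho.
(* The hypothesis P > rho serves as the lower bound that yields a hitting set of the clauses of size
   3; the tolerance is the gap. *)
have [C HC] := approximation_hitting 2 rho0 eps0.
exists C => n phi k3 Hp.
have [|V [H [szV HV nH HVp]]] := HC n _ (kcnf_nontautological k3) (all_nontautological phi).
  by rewrite prob_nontautological ltW.
exists V => // vs Hvs.
rewrite /accepts prob_keep_designated mulrC; set p := prob (keep (designated n vs) _).
have C0 : (0 < 2 ^+ size vs :> rat)%R by rewrite exprn_gt0.
rewrite ler_pM2l // ltr_pM2l //.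
have des x : (x \in designated n vs) = (bits (x : 'I_n) \in vs).
  by rewrite mem_filter mem_enum andbT.
(* The gap at work: [p] lies in the spectrum and exceeds [rho - eps]. *)
have le_p : (rho <= p)%R.
  rewrite leNgt; apply/negP => lt_p.
  have /Hgap/(_ lt_p) : spectrum 3 p.
    exists n, (keep (designated n vs) (nontautological phi)); split=> //.
    apply/allP => c' /mapP[c cphi ->]; rewrite size_filter (leq_trans (count_size _ _)) //.
    exact: (allP (kcnf_nontautological k3)).
  rewrite leNgt => /negP; apply; apply: lt_le_trans (le_trans HVp _).
    by rewrite prob_nontautological ltrD2r.
  apply: keep_mono_in => c l; rewrite mem_filter des => /andP[_ cphi] lc lV.
  exact: Hvs cphi lc lV.
rewrite le_p /=; case: ltP => //= le_p'.
set psi := keep (designated n vs) (nontautological phi) in p le_p le_p'.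
have [a sa nsa] : exists2 a, satisfies a phi & ~~ satisfies a psi.
  case: (boolP [exists a, satisfies a phi && ~~ satisfies a psi]).
    by move=> /existsP[a /andP[]]; exists a.
  move=> /existsPn Hn; have := lt_le_trans Hp (le_trans (prob_mono _) le_p').
  by rewrite ltxx => H'; case: notF; apply: H' => a sa; have := Hn a; rewrite sa negbK.
pose a' (u : seq bool) := [exists x : 'I_n, (bits x == u) && a x].
have a'E (x : 'I_n) : a' (bits x) = a x.
  apply/existsP/idP => [[y /andP[/eqP /bits_inj /val_inj -> //]]|ax].
  by exists x; rewrite eqxx.
pose alpha := map a' vs.
have val_alpha u b : value vs alpha u = Some b -> b = a' u.
  by rewrite /alpha; elim: (vs) => //= v vs' IH; case: eqP => [-> [->]|_ /IH].
have Es : size alpha = size vs by rewrite size_map.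
have mixE : mix vs alpha a = a.
  apply/ffunP=> x; rewrite ffunE; case Ev: (value _ _ _) => [b|//] /=.
  by rewrite (val_alpha _ _ Ev) a'E.
apply/hasP; exists alpha; first by rewrite mem_bool_words Es.
(* The restriction of [a] leaves an active clause because [a] falsifies [psi]. *)
rewrite has_active -[has _ _]negbK -(satisfies_mix_keep a) // mixE nsa /=.
apply: (extendable_complete sa k3) => [x b /val_alpha ->|c cphi ac]; first by rewrite a'E.
have /andP[nt _] := ac.
have cnt : c \in nontautological phi by rewrite mem_filter nt.
have /orP[->//|/andP[/hasP[l lc lH] _]] := allP nH c cnt.
apply/orP; right; apply/hasP; exists l => //.
by rewrite -(value_some _ Es); apply: Hvs cphi lc _; exact: HV.
Qed.

(** * The query defining the language *)

Definition FSign i := FLetter literal_sign i.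
Definition FSameSign i j :=
  FOr (FAnd (FSign i) (FSign j)) (FAnd (FNeg (FSign i)) (FNeg (FSign j))).
Definition FInClause k z := FAnd (FLetter is_literal z) (FSame is_clause z k).

(* A list [L] of variables and bits describes a partial assignment: it maps the key at
   the position of a variable to the corresponding bit. *)
Fixpoint FTrueLiteral (L : seq (nat * bool)) z : query :=
  if L is (x, b) :: L' then
    FOr (FAnd (FKeyEq x z) (if b then FSign z else FNeg (FSign z)))
        (FAnd (FNeg (FKeyEq x z)) (FTrueLiteral L' z))
  else FNeg FTrue.
Definition FUnassigned (L : seq (nat * bool)) z : query :=
  FConj [seq FNeg (FKeyEq p.1 z) | p <- L].

(* The variables below 10 are bound: 1 is a clause, 7 and 8 are the ends of an edge, and
   the others are literals.  The pointers are the variables from 10 on. *)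
Definition FTautology :=
  FEx 2 (FEx 3 (FConj [:: FInClause 1 2; FInClause 1 3; FKeyEq 2 3; FSign 2; FNeg (FSign 3)])).
Definition FActive L :=
  FConj [:: FLetter is_clause 1; FNeg FTautology;
            FNeg (FEx 2 (FAnd (FInClause 1 2) (FTrueLiteral L 2)))].
Definition FFree L z := FAnd (FInClause 1 z) (FUnassigned L z).
Definition FResidual L z :=
  FConj [:: FFree L z; FFree L 5;
            FAll 6 (FImp (FFree L 6) (FOr (FSamePos 6 z) (FSamePos 6 5)))].
Definition FEdge L :=
  FOr (FAnd (FKeyEq 7 8) (FSameSign 7 8))
      (FEx 5 (FAnd (FEx 1 (FAnd (FActive L) (FResidual L 7)))
                   (FAnd (FKeyEq 5 8) (FNeg (FSameSign 5 8))))).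
Definition FExtendable L :=
  FAnd (FAll 1 (FImp (FActive L) (FEx 4 (FEx 5 (FResidual L 4)))))
       (FNeg (FEx 2 (FEx 3 (FConj
          [:: FAnd (FKeyEq 2 3) (FNeg (FSameSign 2 3));
              FReach 7 8 (FEdge L) 2 3; FReach 7 8 (FEdge L) 3 2])))).

(** The comparison with [rho] is made while the query is built; evaluation only branches on the
    truth values of the subqueries. *)
Fixpoint FCount (g : pred nat) (fs : seq query) (k : nat) : query :=
  if fs is f :: fs' then
    FOr (FAnd f (FCount g fs' k.+1)) (FAnd (FNeg f) (FCount g fs' k))
  else if g k then FTrue else FNeg FTrue.

Lemma eval_FCount g fs k s e :
  eval (FCount g fs k) s e = g (k + count (fun f => eval f s e) fs).
Proof.
elim: fs k => [|f fs IH] k /=; first by rewrite addn0; case: ifP => // _; rewrite eval_FNeg.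
rewrite eval_FOr !eval_FAnd eval_FNeg !IH addSnnS.
by case: (eval f s e) => /=; rewrite ?orbF.
Qed.

Definition FAccepts (rho : rat) (xs : seq nat) :=
  let fs := [seq FNeg (FEx 1 (FActive (zip xs alpha))) | alpha <- bool_words (size xs)] in
  FAnd (FCount (fun k => (rho * 2 ^+ size xs <= k%:R)%R) fs 0)
    (FOr (FCount (fun k => (rho * 2 ^+ size xs < k%:R)%R) fs 0)
         (FDisj [seq FAnd (FEx 1 (FActive (zip xs alpha))) (FExtendable (zip xs alpha))
                 | alpha <- bool_words (size xs)])).

Definition FLanguage (rho : rat) (C : nat) :=
  FAnd FFormat (FAnd FNumberLt (foldr FEx (FAccepts rho (iota 10 C)) (iota 10 C))).

(** * Evaluation of the queries *)

Lemma eval_FSign i s e : valid_env s e -> eval (FSign i) s e = sign_at s (e i).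
Proof. exact: eval_FLetter. Qed.

Lemma eval_FSameSign i j s e : valid_env s e ->
  eval (FSameSign i j) s e = (sign_at s (e i) == sign_at s (e j)).
Proof.
move=> He; rewrite eval_FOr !eval_FAnd !eval_FNeg !eval_FSign //.
by case: (sign_at s (e i)); case: (sign_at s (e j)).
Qed.

Lemma eval_FInClause k z s e : valid_env s e ->
  eval (FInClause k z) s e = (e z \in literals_of_clause s (rank is_clause s (e k))).
Proof.
move=> He; rewrite eval_FAnd eval_FLetter // eval_FSame //.
by rewrite mem_filter mem_iota leq0n add0n (He z) !andbT.
Qed.

Lemma eval_FTrueLiteral xs alpha z s e : valid_env s e ->
  eval (FTrueLiteral (zip xs alpha) z) s e =
  (value [seq key s (e x) | x <- xs] alpha (key s (e z)) == Some (sign_at s (e z))).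
Proof.
move=> He; elim: xs alpha => [|x xs IH] [|b alpha] //=.
rewrite eval_FOr !eval_FAnd eval_FNeg eval_FKeyEq IH.
case: (key s (e x) == key s (e z)); rewrite ?andTb ?andFb ?orbF //.
by case: b; rewrite ?eval_FNeg eval_FSign //; case: (sign_at _ _).
Qed.

Lemma eval_FUnassigned xs alpha z s e : size alpha = size xs ->
  eval (FUnassigned (zip xs alpha) z) s e =
  (value [seq key s (e x) | x <- xs] alpha (key s (e z)) == None).
Proof.
rewrite eval_FConj all_map; elim: xs alpha => [|x xs IH] [|b alpha] //= [Es].
by rewrite eval_FNeg eval_FKeyEq IH //; case: eqP.
Qed.

Definition pointers_fix (xs : seq nat) (s : seq symbol) (vs : seq (seq bool)) (e : nat -> nat) :=
  valid_env s e /\ [seq key s (e x) | x <- xs] = vs.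

Lemma pointers_fix_update xs s vs e j p : all (leq 10) xs -> j < 10 -> p < size s ->
  pointers_fix xs s vs e -> pointers_fix xs s vs (update e j p).
Proof.
move=> /allP Hxs ltj ltp [He <-]; split; first exact: valid_update.
apply/eq_in_map => x /Hxs le10; rewrite /update; case: eqP => // Ex.
by rewrite Ex leqNgt ltj in le10.
Qed.

Lemma eval_FTautology s e : valid_env s e ->
  eval FTautology s e =
  has (fun l : raw_literal => (~~ l.1, l.2) \in clause_at s (e 1)) (clause_at s (e 1)).
Proof.
move=> He; set L := literals_of_clause s (rank is_clause s (e 1)).
transitivity (has (fun z => has (fun y => [&& z \in L, y \in L, key s z == key s y,
    sign_at s z & ~~ sign_at s y]) (iota 0 (size s))) (iota 0 (size s))).
  apply: eval_FEx => // z ltz Hz; apply: eval_FEx => // y lty Hy.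
  by rewrite eval_FConj /= !eval_FInClause // eval_FKeyEq eval_FNeg !eval_FSign // andbT.
have ltL z : z \in L -> z < size s by rewrite mem_filter mem_iota => /andP[].
rewrite /clause_at -/L; apply/has_iota/hasP.
  move=> [z ltz /has_iota[y lty /and5P[zL yL /eqP Ek sz nsy]]].
  exists (literal_at s z); first exact: map_f.
  apply/mapP; exists y => //; rewrite /literal_at -Ek -/(sign_at s z) -/(sign_at s y).
  by rewrite sz (negbTE nsy).
move=> [l /mapP[z zL ->] /mapP[y yL []]]; rewrite -/(sign_at s z) -/(sign_at s y) => Es Ek.
case Ez: (sign_at s z) Es => Es.
  exists z; first exact: ltL; apply/has_iota; exists y; first exact: ltL.
  by rewrite zL yL Ek eqxx Ez -Es.
exists y; first exact: ltL; apply/has_iota; exists z; first exact: ltL.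
by rewrite zL yL Ek eqxx Ez -Es.
Qed.

Section Evaluation.

Variables (xs : seq nat) (alpha : seq bool) (s : seq symbol) (vs : seq (seq bool)).
Hypotheses (le10 : all (leq 10) xs) (size_alpha : size alpha = size xs).
Let L := zip xs alpha.
Let fixed e := pointers_fix xs s vs e.

Lemma fixed_update e j p : j < 10 -> p < size s -> fixed e -> fixed (update e j p).
Proof. exact: pointers_fix_update. Qed.

Lemma eval_FActive e : fixed e -> eval (FActive L) s e = active_at s vs alpha (e 1).
Proof.
move=> He; have [va Evs] := He.
rewrite eval_FConj /= !eval_FNeg eval_FLetter // eval_FTautology // andbT.
rewrite /active_at /raw_active; congr [&& _, _ & ~~ _].
set M := literals_of_clause s (rank is_clause s (e 1)).
transitivity (has (fun z => (z \in M) && (value vs alpha (key s z) == Some (sign_at s z)))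
   (iota 0 (size s))).
  apply: eval_FEx => // z ltz Hz; rewrite eval_FAnd eval_FInClause // eval_FTrueLiteral //.
  by have [_ ->] := fixed_update (isT : 2 < 10) ltz He.
rewrite /clause_at has_map; apply/has_iota/hasP => [[z ltz /andP[zM Hz]]|[z zM Hz]].
  by exists z.
by exists z; [move: zM; rewrite mem_filter mem_iota => /andP[] | rewrite zM].
Qed.

Lemma eval_FFree e z : fixed e -> eval (FFree L z) s e = free_at s vs alpha (e 1) (e z).
Proof.
by move=> [va Evs]; rewrite eval_FAnd eval_FInClause // eval_FUnassigned // Evs.
Qed.

Lemma eval_FResidual e z : z != 6 -> fixed e ->
  eval (FResidual L z) s e = residual s vs alpha (e 1) (e z) (e 5).
Proof.
move=> nz He; have [va _] := He; rewrite eval_FConj /= !eval_FFree // andbT.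
congr [&& _, _ & _]; apply: eval_FAll_eq => // u ltu Hu.
have He' := fixed_update (isT : 6 < 10) ltu He.
rewrite eval_FImp eval_FOr eval_FFree // !eval_FSamePos //.
by rewrite /update /= (negbTE nz).
Qed.

Lemma eval_FEdge e : fixed e -> eval (FEdge L) s e = falsity_edge s vs alpha (e 7) (e 8).
Proof.
move=> He; have [va _] := He.
rewrite eval_FOr eval_FAnd eval_FKeyEq eval_FSameSign //; congr (_ || _).
apply: eval_FEx => // y lty Hy; have He5 := fixed_update (isT : 5 < 10) lty He.
rewrite !eval_FAnd eval_FNeg eval_FKeyEq eval_FSameSign //; congr (_ && _).
apply: eval_FEx => // k ltk Hk; have He1 := fixed_update (isT : 1 < 10) ltk He5.
by rewrite eval_FAnd eval_FActive // eval_FResidual.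
Qed.

Lemma eval_FReachEdge e c d : fixed e ->
  eval (FReach 7 8 (FEdge L) c d) s e =
  reachable (size s) (falsity_edge s vs alpha) (e c) (e d).
Proof.
move=> He; have [va _] := He.
have -> : e c = Ordinal (va c) by []; have -> : e d = Ordinal (va d) by [].
apply/esym; rewrite [RHS]/eval -/eval.
pose r' (x y : 'I_(size s)) := falsity_edge s vs alpha x y.
rewrite (reachable_connect _ _ (r' := r')) //.
rewrite (@reachable_connect _ _ (Ordinal (va c)) (Ordinal (va d)) r') //.
move=> x y; rewrite eval_FEdge //.
by apply: fixed_update => //; exact: fixed_update.
Qed.

Lemma eval_FExtendable e : fixed e -> eval (FExtendable L) s e = extendable s vs alpha.
Proof.
move=> He; have [va _] := He; rewrite eval_FAnd eval_FNeg /extendable; congr (_ && ~~ _).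
  apply: eval_FAll_eq => // k ltk Hk; have He1 := fixed_update (isT : 1 < 10) ltk He.
  rewrite eval_FImp eval_FActive //; congr (_ ==> _).
  apply: eval_FEx => // z ltz Hz; have He4 := fixed_update (isT : 4 < 10) ltz He1.
  apply: eval_FEx => // y lty Hy; have He5 := fixed_update (isT : 5 < 10) lty He4.
  by rewrite eval_FResidual.
apply: eval_FEx => // z ltz Hz; have He2 := fixed_update (isT : 2 < 10) ltz He.
apply: eval_FEx => // w ltw Hw; have He3 := fixed_update (isT : 3 < 10) ltw He2.
rewrite eval_FConj /= eval_FAnd eval_FNeg eval_FKeyEq eval_FSameSign //.
by rewrite !eval_FReachEdge // andbT.
Qed.

Lemma eval_FHasActive e : fixed e ->
  eval (FEx 1 (FActive L)) s e = has (active_at s vs alpha) (iota 0 (size s)).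
Proof.
move=> He; have [va _] := He; apply: eval_FEx => // k ltk Hk.
by rewrite eval_FActive //; exact: fixed_update.
Qed.

End Evaluation.

Lemma eval_FAccepts rho xs s vs e : all (leq 10) xs -> pointers_fix xs s vs e ->
  eval (FAccepts rho xs) s e = accepts rho s vs.
Proof.
move=> le10 He; have [_ Evs] := He.
have Esz : size vs = size xs by rewrite -Evs size_map.
rewrite eval_FAnd eval_FOr !eval_FCount eval_FDisj has_map count_map !add0n /accepts Esz.
have szw alpha : alpha \in bool_words (size xs) -> size alpha = size xs.
  by rewrite mem_bool_words => /eqP.
have -> : count (preim (fun alpha => FNeg (FEx 1 (FActive (zip xs alpha)))) (fun f => eval f s e))
     (bool_words (size xs)) =
   count (fun alpha => ~~ has (active_at s vs alpha) (iota 0 (size s))) (bool_words (size xs)).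
  apply: eq_in_count => alpha /szw Ea /=.
  by rewrite eval_FNeg (@eval_FHasActive xs alpha s vs le10 e He).
congr (_ && (_ || _)); apply: eq_in_has => alpha /szw Ea /=.
rewrite eval_FAnd (@eval_FHasActive xs alpha s vs le10 e He).
by rewrite (@eval_FExtendable xs alpha s vs le10 Ea e He).
Qed.

Lemma eval_FExs js f s e : valid_env s e ->
  eval (foldr FEx f js) s e <->
  exists e', [/\ valid_env s e', forall j, j \notin js -> e' j = e j & eval f s e'].
Proof.
elim: js e => [|j js IH] e He /=.
  split=> [Hf|[e' [He' Ee Hf]]]; first by exists e.
  by rewrite -(functional_extensionality e' e) // => j; apply: Ee.
split.
  move=> /has_iota[p ltp] /(IH _ (valid_update j He ltp))[e' [He' Ee Hf]].
  exists e'; split=> // k; rewrite inE negb_or => /andP[nkj /Ee ->].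
  by rewrite /update (negbTE nkj).
move=> [e' [He' Ee Hf]]; apply/has_iota; exists (e' j) => //.
apply/(IH _ (valid_update j He (He' j))); exists e'; split=> // k nk.
rewrite /update; case: eqP => [-> //|/eqP nkj].
by apply: Ee; rewrite inE negb_or nkj.
Qed.

(** The witness is the last letter in [P] at or before [z]; for [is_clause], it opens the clause
    containing [z]. *)
Lemma rank_witness (P : pred symbol) s z : z < size s -> 0 < rank P s z ->
  exists k, [/\ k < size s, P (letter_at s k) & rank P s k = rank P s z].
Proof.
elim: z => [|z IH] ltz.
  rewrite /rank (take_nth Clause ltz) take0 /= addn0 -/(letter_at s 0) => H0.
  exists 0; split=> //; first by case: (P _) H0.
  by rewrite /rank (take_nth Clause ltz) take0 /= addn0.
have ES : rank P s z.+1 = rank P s z + P (letter_at s z.+1).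
  by rewrite /rank (take_nth Clause ltz) -cats1 count_cat /= addn0.
case: (boolP (P (letter_at s z.+1))) => [Pz|nPz] H0; first by exists z.+1.
rewrite ES (negbTE nPz) addn0 in H0 *; exact: IH (ltnW ltz) H0.
Qed.

Lemma raw_literals s u cs : raw_of s = Some (u, [::], cs) ->
  forall z, z < size s -> is_literal (letter_at s z) ->
  exists2 c, c \in cs & literal_at s z \in c.
Proof.
move=> Er z ltz lz; have [_ E1 E2] := raw_of_positions Er.
have r0 : 0 < rank is_clause s z.
  rewrite lt0n; apply/negP => /eqP Ez.
  have : z \in literals_of_clause s 0 by rewrite mem_filter lz Ez mem_iota.
  by move=> /(map_f (literal_at s)); rewrite -E1.
have [k [ltk ck Ek]] := rank_witness ltz r0.
exists (map (literal_at s) (literals_of_clause s (rank is_clause s k))).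
  by rewrite E2; apply: map_f; rewrite mem_filter ck mem_iota.
by apply: map_f; rewrite mem_filter lz Ek eqxx mem_iota.
Qed.

Lemma raw_literal_position s u cs c l : raw_of s = Some (u, [::], cs) -> c \in cs -> l \in c ->
  exists z, [/\ z < size s, is_literal (letter_at s z) & literal_at s z = l].
Proof.
move=> Er; have [_ _ E2] := raw_of_positions Er; rewrite E2 => /mapP[k _ ->] /mapP[z].
by rewrite mem_filter mem_iota => /andP[/andP[lz _] /andP[_ ltz]] ->; exists z.
Qed.

Lemma map_surj (T U : eqType) (f : T -> U) (r : seq U) :
  (forall y, y \in r -> exists x, y = f x) -> exists t, r = map f t.
Proof.
elim: r => [|y r IH] H; first by exists [::].
have [x ->] := H y (mem_head _ _).
have [|t ->] := IH; last by exists (x :: t).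
by move=> y' y'r; apply: H; rewrite inE y'r orbT.
Qed.

Lemma encodedP s e : valid_env s e ->
  (eval FFormat s e && eval FNumberLt s e) <->
  exists n (phi : cnf n), s = encode_cnf phi /\ is_kcnf 3 phi.
Proof.
move=> He; rewrite eval_FFormat; split.
  move=> /andP[]; case Er: (raw_of s) => [[[u ls] cs]|] //.
  rewrite /raw_format /= => /and4P[cu /eqP El _ /allP kcs].
  rewrite {ls}El in Er.
  have [Eu _ _] := raw_of_positions Er.
  have ck z : z < size s -> is_literal (letter_at s z) -> canonical_bits (key s z).
    move=> ltz lz; have [c ccs lc] := raw_literals Er ltz lz.
    by have /andP[_ /allP/(_ _ lc)] := kcs c ccs.
  rewrite eval_FNumberLt ?Eu // => /allP Hlt.
  pose n := bits_value u.
  have [phi Ephi] : exists phi : cnf n, cs = map (map (@raw_literal_of n)) phi.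
    apply: map_surj => c ccs; apply: map_surj => -[b v] lc.
    have [z [ltz lz El]] := raw_literal_position Er ccs lc.
    have Hv : bits_value v < n.
      have := Hlt z; rewrite mem_iotaP ltz lz => /(_ isT) /=.
      by move: El => [_ ->].
    exists (Ordinal Hv, b); rewrite /raw_literal_of /= bits_bits_value //.
    by have /andP[_ /allP/(_ _ lc)] := kcs c ccs.
  exists n, phi; split.
    rewrite (raw_ofP Er); have := raw_of_cnf phi.
    by rewrite bits_bits_value // -Ephi => /raw_ofP.
  apply/allP => c cphi; have := kcs _ (_ : map (@raw_literal_of n) c \in cs).
  by rewrite Ephi map_f // => /(_ isT) /andP[]; rewrite size_map.
move=> [n [phi [Es k3]]]; have Er := raw_of_cnf phi; rewrite -Es in Er.
have [Eu _ _] := raw_of_positions Er.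
have lit z : z < size s -> is_literal (letter_at s z) ->
    exists x : 'I_n, key s z = bits x.
  move=> ltz lz; have [c /mapP[c' _ ->] /mapP[l _ [_ E]]] := raw_literals Er ltz lz.
  by exists l.1.
rewrite eval_FNumberLt // ?Eu ?canonical_bits_bits //; last first.
  by move=> z ltz lz; have [x ->] := lit z ltz lz; exact: canonical_bits_bits.
rewrite Er /raw_format /= canonical_bits_bits /=; apply/andP; split.
  apply/allP => c' /mapP[c cphi ->]; rewrite /canonical_clause size_map (allP k3) //=.
  by apply/allP => l' /mapP[l _ ->]; exact: canonical_bits_bits.
apply/allP => z; rewrite mem_iotaP => ltz; apply/implyP => lz.
by have [x ->] := lit z ltz lz; rewrite !bits_value_bits.
Qed.

Lemma prob_gtE n (phi : cnf n) (rho : rat) :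
  (rho < prob phi)%R = (rho * 2 ^+ n < (num_sat phi)%:R)%R.
Proof. by rewrite /prob ltr_pdivlMr // exprn_gt0. Qed.

(** A variable of [V] that does not occur in [phi] gets the dummy pointer 0, a valid position as the
    word is not empty. *)
Lemma pointers_exist n (phi : cnf n) (V : seq 'I_n) : 0 < size (encode_cnf phi) ->
  exists ps : seq nat, [/\ size ps = size V, all (fun p => p < size (encode_cnf phi)) ps &
    forall c l, c \in phi -> l \in c -> l.1 \in V ->
      bits l.1 \in map (key (encode_cnf phi)) ps].
Proof.
move=> lt0; elim: V => [|x V [ps [szp ltp Hps]]]; first by exists [::].
case: (boolP (has (has (fun l : literal n => l.1 == x)) phi)) => [|nx].
  move=> /hasP[c cphi /hasP[l lc /eqP lx]].
  have [z ltz Ez] := occurrence cphi lc.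
  exists (z :: ps); rewrite /= szp ltz ltp; split=> // c' l' c'phi l'c'.
  rewrite inE => /orP[/eqP ->|l'V]; first by rewrite -lx -Ez inE eqxx.
  by rewrite inE (Hps c') ?orbT.
exists (0 :: ps); rewrite /= szp ltp lt0; split=> // c' l' c'phi l'c'.
rewrite inE => /orP[lx|l'V]; last by rewrite inE (Hps c') ?orbT.
by case/hasP: nx; exists c' => //; apply/hasP; exists l'.
Qed.

Theorem theorem7p7 (B : nat) (rho : rat) (rho_gt0 : (0 < rho)%R)
  (rho_lt1 : (rho < 1)%R) (den_rho : (denq rho <= B%:Z)%R) :
  in_P (GtTHR_3SAT rho).
Proof.
have [C HC] := accepts_complete rho_gt0.
apply: (testable_of_in_P (testable_query (FLanguage rho C))) => s.
have le10 : all (leq 10) (iota 10 C) by apply/allP => i; rewrite mem_iota => /andP[].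
(* The empty word encodes the empty formula on no variable, whose probability 1 exceeds [rho]; it
   has no positions to quantify over. *)
case: (s =P [::]) => [->|/eqP s0] /=.
  split=> // _; exists 0, [::]; split=> //.
  rewrite expr0 mulr1 /num_sat (_ : [set a | _] = setT).
    by rewrite cardsT card_ffun card_bool card_ord.
  by apply/setP => a; rewrite !inE.
have lt0 : 0 < size s by case: (s) s0.
have va : valid_env s (fun=> 0) by [].
rewrite eval_FAnd eval_FAnd andbA; split.
  move=> /andP[/(encodedP va)[n [phi [Es k3]]] /(eval_FExs _ _ va)[e' [va' _]]].
  rewrite (eval_FAccepts _ le10 (vs := [seq key s (e' x) | x <- iota 10 C])) // Es.
  by move=> /accepts_sound; rewrite prob_gtE; exists n, phi.
move=> [n [phi [Es k3]]]; rewrite -prob_gtE => Hp.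
apply/andP; split; first by apply/(encodedP va); exists n, phi.
have [V szV HV] := HC n phi k3 Hp.
rewrite Es in lt0; have [ps [szp /allP ltp Hps]] := pointers_exist V lt0.
apply/(eval_FExs _ _ va).
exists (fun j => if 10 <= j then nth 0 ps (j - 10) else 0); split.
- move=> j; rewrite Es; case: ifP => // _; case: (ltnP (j - 10) (size ps)) => ltj.
    exact/ltp/mem_nth.
  by rewrite nth_default.
- move=> j; rewrite mem_iota negb_and; case: ifP => //= _ ltj.
  by rewrite nth_default //; lia.
(* The query has exactly [C] pointers, so missing ones are set to position 0; extra keys are
   harmless to [accepts_complete]. *)
rewrite (eval_FAccepts _ le10 (vs := map (key s) (ps ++ nseq (C - size ps) 0))).
  rewrite Es; apply: HV => c l cphi lc lV; rewrite map_cat mem_cat.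
  by rewrite (Hps c l).
split.
  move=> j; rewrite Es; case: ifP => // _; case: (ltnP (j - 10) (size ps)) => ltj.
    exact/ltp/mem_nth.
  by rewrite nth_default.
apply: (@eq_from_nth _ [::]) => [|i].
  by rewrite !size_map size_iota size_cat size_nseq subnKC ?szp.
rewrite size_map size_iota => lti.
rewrite !(nth_map 0) ?size_iota ?size_cat ?size_nseq ?subnKC ?szp // nth_iota //.
by rewrite leq_addr addKn nth_cat nth_nseq; case: ltnP => // H; rewrite if_same nth_default.
Qed.
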